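(* For any grapheur $\mathsf M\in\mathcal M$ and $n\in\mathbb N$, let $\mathsf G^{(n)}[\mathsf M]$ be the random graph obtained by sampling $n$ edges from $\mathsf M$. Then $\mathbb E\big[W_\square(\mathsf M,\mathsf M_{\mathsf G^{(n)}[\mathsf M]})\big]\le\mathbb E\big[\overline{W_\square}(\mathsf M,\mathsf M_{\mathsf G^{(n)}[\mathsf M]})\big]\le\frac{174}{\sqrt n}$, where the expectation is over the realization of $\mathsf G^{(n)}[\mathsf M]$. Moreover, for every $\epsilon>0$, with probability at least $1-\exp(-2\epsilon^2)$ over $\mathsf G^{(n)}[\mathsf M]$, $W_\square(\mathsf M,\mathsf M_{\mathsf G^{(n)}[\mathsf M]})\le\overline{W_\square}(\mathsf M,\mathsf M_{\mathsf G^{(n)}[\mathsf M]})\le\frac{174+\epsilon}{\sqrt n}$.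
   Context: A grapheur is a random probability measure on $[0,1]^2$ of the form $\sum_{i,j}E_{i,j}\delta_{(T_i,T_j)}+\sum_i[\sigma_i(\delta_{T_i}\otimes\lambda)+\varsigma_i(\lambda\otimes\delta_{T_i})]+\theta\lambda^2+\vartheta\lambda_D$ ($T_i$ iid uniform; $\lambda,\lambda^2$ Lebesgue; $\lambda_D$ uniform probability on the diagonal; deterministic nonnegative coefficients summing to $1$); $\mathcal M$ is the set of grapheurs. For a deterministic $G\in\Delta^{m\times m}$ (nonnegative, entries summing to $1$), $\mathsf M_G=\sum_{i,j}G_{i,j}\delta_{(T_i,T_j)}$ with $T_1,\dots,T_m$ iid uniform. Edge sampling: sample $\mu\sim\mathsf M$, then $(x_1,y_1),\dots,(x_n,y_n)$ iid from $\mu$; enumerate the distinct points $\{x_l\}\cup\{y_l\}=\{t_1,\dots,t_N\}$ arbitrarily and set $(\mathsf G^{(n)}[\mathsf M])_{i,j}=|\{l:(x_l,y_l)=(t_i,t_j)\}|/n$. For grapheurs (or random measures) $\mathsf M_1,\mathsf M_2$, with infima over couplings $(\mathsf M_1',\mathsf M_2')$ and suprema over intervals $S,T\subseteq[0,1]$: $W_\square(\mathsf M_1,\mathsf M_2)=\inf\sup_{S,T}\mathbb E|\mathsf M_1'(S\times T)-\mathsf M_2'(S\times T)|$ and $\overline{W_\square}(\mathsf M_1,\mathsf M_2)=\inf\mathbb E\sup_{S,T}|\mathsf M_1'(S\times T)-\mathsf M_2'(S\times T)|$. *)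

(* Defs.v *)
From HB Require Import structures.
From mathcomp Require Import all_boot all_order all_algebra.
From mathcomp Require Import all_classical all_reals all_analysis.
From mathcomp Require Import measurable_realfun.
Set Implicit Arguments. Unset Strict Implicit. Unset Printing Implicit Defensive.
Import Order.TTheory GRing.Theory Num.Theory.
Local Open Scope classical_set_scope.
Local Open Scope ring_scope.

Definition unit_itv {R : realType} : set (measurableTypeR R) := `[0%R, 1%R].

(* A deterministic family of grapheur coefficients: E_{i,j}, sigma_i,
   varsigma_i, theta, vartheta (countable index set nat; finitely many
   nonzero terms is the special case where the others vanish). *)
Definition grapheur_coeffs (R : realType) (E : nat -> nat -> R)
    (sg vs : nat -> R) (th vth : R) : Prop :=
  (forall i j, 0 <= E i j) /\ (forall i, 0 <= sg i) /\ (forall i, 0 <= vs i)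
  /\ 0 <= th /\ 0 <= vth /\
  ((\sum_(i <oo) \sum_(j <oo) (E i j)%:E + \sum_(i <oo) (sg i)%:E
     + \sum_(i <oo) (vs i)%:E + th%:E + vth%:E) = 1)%E.

(* The measure  sum E_ij delta_(t_i,t_j) + sum sg_i (delta_{t_i} x lambda)
   + sum vs_i (lambda x delta_{t_i}) + th lambda^2 + vth lambda_D
   (lambda = Lebesgue on [0,1], lambda_D = uniform on the diagonal),
   given the values t_i of the points T_i. *)
Definition grapheur_measure (R : realType) (E : nat -> nat -> R)
    (sg vs : nat -> R) (th vth : R) (t : nat -> measurableTypeR R) : set (measurableTypeR R * measurableTypeR R) -> \bar R :=
  fun A =>
  (\sum_(i <oo) \sum_(j <oo) (E i j)%:E * (\1_A (t i, t j))%:E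
  + \sum_(i <oo) (sg i)%:E *
        (@lebesgue_measure R) [set y | unit_itv y /\ A (t i, y)]
  + \sum_(i <oo) (vs i)%:E *
        (@lebesgue_measure R) [set x | unit_itv x /\ A (x, t i)]
  + th%:E * ((@lebesgue_measure R) \x (@lebesgue_measure R))
        (A `&` (unit_itv `*` unit_itv))
  + vth%:E * (@lebesgue_measure R) [set x | unit_itv x /\ A (x, x)])%E.

Definition grapheur_rm (R : realType) d (Om : measurableType d)
    (E : nat -> nat -> R) (sg vs : nat -> R) (th vth : R)
    (T : nat -> Om -> measurableTypeR R) : Om -> set (measurableTypeR R * measurableTypeR R) -> \bar R :=
  fun w => grapheur_measure E sg vs th vth (fun i => T i w).

Definition iid_uniform01 (R : realType) d (Om : measurableType d)
    (P : probability Om R) (T : nat -> Om -> measurableTypeR R) : Prop :=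
  (forall i, measurable_fun setT (T i)) /\
  forall (k : nat) (idx : 'I_k -> nat), injective idx ->
  forall B : 'I_k -> set (measurableTypeR R), (forall i, measurable (B i)) ->
  P [set w | forall i, B i (T (idx i) w)] =
  ((\prod_(i < k) fine ((@lebesgue_measure R) (B i `&` unit_itv)))%:E).

Definition graph_measure (R : realType) (N : nat) (G : 'M[R]_N) (t : nat -> measurableTypeR R)
    : set (measurableTypeR R * measurableTypeR R) -> \bar R :=
  fun A => (\sum_(i < N) \sum_(j < N) (G i j)%:E * (\1_A (t i, t j))%:E)%E.

Definition sample_vertices (R : realType) (pts : seq (measurableTypeR R * measurableTypeR R)) : seq (measurableTypeR R) :=
  undup (flatten [seq [:: p.1; p.2] | p <- pts]).

Definition sample_graph (R : realType) (pts : seq (measurableTypeR R * measurableTypeR R))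
    : 'M[R]_(size (sample_vertices pts)) :=
  \matrix_(i, j)
    ((count (pred1 (nth 0 (sample_vertices pts) i,
                    nth 0 (sample_vertices pts) j)) pts)%:R
      / (size pts)%:R).

Fixpoint iid_integral (R : realType) (m : set (measurableTypeR R * measurableTypeR R) -> \bar R) (k : nat)
    (F : seq (measurableTypeR R * measurableTypeR R) -> \bar R) : \bar R :=
  match k with
  | 0 => F [::]
  | k'.+1 => (\int[m]_z iid_integral m k' (fun s => F (z :: s)))%E
  end.

Definition sample_expect (R : realType) d (Om : measurableType d)
    (P : probability Om R) (M : Om -> set (measurableTypeR R * measurableTypeR R) -> \bar R) (n : nat)
    (F : seq (measurableTypeR R * measurableTypeR R) -> \bar R) : \bar R :=
  (\int[P]_w iid_integral (M w) n F)%E.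

Definition is_random_measure (R : realType) d (Om : measurableType d)
    (M : Om -> set (measurableTypeR R * measurableTypeR R) -> \bar R) : Prop :=
  (forall w, M w set0 = 0%E /\ (forall A, measurable A -> (0 <= M w A)%E)
             /\ semi_sigma_additive (M w)) /\
  (forall A, measurable A -> measurable_fun [set: Om] (fun w : Om => M w A)).

(* Equality in law of two random measures (finite-dimensional laws of the
   evaluation maps, i.e. the laws on the evaluation sigma-algebra). *)
Definition same_law (R : realType) d1 (Om1 : measurableType d1)
    (P1 : probability Om1 R) (M1 : Om1 -> set (measurableTypeR R * measurableTypeR R) -> \bar R)
    d2 (Om2 : measurableType d2)
    (P2 : probability Om2 R) (M2 : Om2 -> set (measurableTypeR R * measurableTypeR R) -> \bar R) : Prop :=
  forall (k : nat) (A : 'I_k -> set (measurableTypeR R * measurableTypeR R)) (B : 'I_k -> set (\bar R)),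
  (forall i, measurable (A i)) -> (forall i, measurable (B i)) ->
  P1 [set w | forall i, B i (M1 w (A i))] =
  P2 [set w | forall i, B i (M2 w (A i))].

Definition sub_interval (R : realType) (S : set (measurableTypeR R)) : Prop :=
  S `<=` unit_itv /\ is_interval S.

Definition is_coupling (R : realType) d1 (Om1 : measurableType d1)
    (P1 : probability Om1 R) (M1 : Om1 -> set (measurableTypeR R * measurableTypeR R) -> \bar R)
    d2 (Om2 : measurableType d2)
    (P2 : probability Om2 R) (M2 : Om2 -> set (measurableTypeR R * measurableTypeR R) -> \bar R)
    d (Om : measurableType d) (P : probability Om R)
    (N1 N2 : Om -> set (measurableTypeR R * measurableTypeR R) -> \bar R) : Prop :=
  is_random_measure N1 /\ is_random_measure N2 /\
  same_law P N1 P1 M1 /\ same_law P N2 P2 M2.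

Definition Wbox (R : realType) d1 (Om1 : measurableType d1)
    (P1 : probability Om1 R) (M1 : Om1 -> set (measurableTypeR R * measurableTypeR R) -> \bar R)
    d2 (Om2 : measurableType d2)
    (P2 : probability Om2 R) (M2 : Om2 -> set (measurableTypeR R * measurableTypeR R) -> \bar R) : \bar R :=
  ereal_inf [set r | exists (d : measure_display) (Om : measurableType d)
     (P : probability Om R) (N1 N2 : Om -> set (measurableTypeR R * measurableTypeR R) -> \bar R),
     is_coupling P1 M1 P2 M2 P N1 N2 /\
     r = ereal_sup [set x | exists S T : set (measurableTypeR R),
           sub_interval S /\ sub_interval T /\
           x = (\int[P]_w `|N1 w (S `*` T) - N2 w (S `*` T)|)%E]].

Definition Wbox_bar (R : realType) d1 (Om1 : measurableType d1)
    (P1 : probability Om1 R) (M1 : Om1 -> set (measurableTypeR R * measurableTypeR R) -> \bar R)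
    d2 (Om2 : measurableType d2)
    (P2 : probability Om2 R) (M2 : Om2 -> set (measurableTypeR R * measurableTypeR R) -> \bar R) : \bar R :=
  ereal_inf [set r | exists (d : measure_display) (Om : measurableType d)
     (P : probability Om R) (N1 N2 : Om -> set (measurableTypeR R * measurableTypeR R) -> \bar R),
     is_coupling P1 M1 P2 M2 P N1 N2 /\
     r = (\int[P]_w ereal_sup [set x | exists S T : set (measurableTypeR R),
           sub_interval S /\ sub_interval T /\
           x = `|N1 w (S `*` T) - N2 w (S `*` T)|%E])%E].

(* Main.v *)
Require Import Defs.
From HB Require Import structures.
From mathcomp Require Import all_boot all_order all_algebra.
From mathcomp Require Import all_classical all_reals all_analysis.
From mathcomp Require Import measurable_realfun.
From mathcomp Require Import ring lra zify.
Set Implicit Arguments. Unset Strict Implicit. Unset Printing Implicit Defensive.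
Import Order.TTheory GRing.Theory Num.Theory.
Import numFieldNormedType.Exports.
Local Open Scope classical_set_scope.
Local Open Scope ring_scope.

(* Encode an edge drawn from the grapheur by its type (which endpoints are
   atoms [T_i], which are fresh uniform points) together with its fresh points.
   Since the isomorphism class of the sampled graph only depends on the types,
   one may couple [M] and [M_G] by redrawing all the [T_i] and all the fresh
   points; the cost of this coupling is a function [mean_dev] of the types.
   Under the law of the types its expectation is the expected supremum of the
   empirical process of [n] iid edges over rectangles, bounded by
   [174 / sqrt n] through symmetrization and dyadic chaining over ranks.
   Changing one type changes [mean_dev] by at most [1/n], so McDiarmid's
   inequality gives the tail bound. *)

(** * Hoeffding's two-point inequality and Rademacher averages *)

(** As a function of the sampled edges, [Wbox_bar] is an infimum over couplings on all probability
    spaces and is not known to be measurable. It is therefore integrated only as a lower integral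
    and compared, by monotonicity, with [mean_dev], which depends on the types alone. Types form a
    countable space on which every function is measurable. The comparison fails only on null events:
    two equal [T_i], or a fresh point that meets an earlier vertex.

    The coupling is an injective choice of entries of one uniform sequence. The redrawn grapheur and
    the redrawn graph share their atoms, so that, given the types, the graph measure is exactly the
    empirical measure of [n] edges decoded with the vertices of the grapheur.

    Origin of [174 = 2 * 87]: the 2 comes from symmetrization, and 87 bounds the product of 4
    (orthants per rectangle), 14.3 (sum of the chain) and the square root of 2 (rounding [n] up to a
    power of 2). In the tail bound, [n] differences of size [1/n] and a deviation of [eps / sqrt n]
    give the exponent [2 eps^2] exactly. *)

Section two_point.
Context {R : realType}.
Implicit Types p u y : R.

Let D p u : R := 1 - p + p * expR u.
(** Logarithm of the right side of [two_point_mgf] minus that of the left side. [psi1] and [psi2]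
    are its first two derivatives in [u]; [psi] and [psi1] vanish at 0 and [psi] is convex. *)
Let psi p u := u ^+ 2 / 8 + p * u - ln (D p u).
Let psi1 p u := u / 4 + p - p * expR u / D p u.
Let psi2 p u := 1 / 4 - p * (1 - p) * expR u / (D p u) ^+ 2.

Let D_gt0 p u : 0 <= p <= 1 -> 0 < D p u.
Proof.
move=> /andP[p0 p1]; rewrite /D; have e0 := expR_gt0 u.
have [->|pn0] := eqVneq p 0; first by lra.
by rewrite ltr_wpDl ?subr_ge0// mulr_gt0// lt0r pn0.
Qed.

Let is_derive_D p u : is_derive u 1 (D p) (p * expR u).
Proof.
rewrite /D; apply: is_derive_eq; rewrite /GRing.scale /=.
by ring.
Qed.

Let is_derive_psi p u : 0 <= p <= 1 -> is_derive u 1 (psi p) (psi1 p u).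
Proof.
move=> hp; have D0 := D_gt0 u hp.
have h1 := is_derive_D p u.
have h2 : is_derive (D p u) 1 (@ln R) (D p u)^-1 by exact: is_derive1_ln.
have h3 := is_derive1_comp h2 h1.
rewrite /psi /psi1; apply: (@is_derive_eq _ _ _ _ _ _ (u / 4 + p - p * expR u / D p u)).
rewrite /GRing.scale /=; field.
by rewrite gt_eqF.
Qed.

Let is_derive_psi1 p u : 0 <= p <= 1 -> is_derive u 1 (psi1 p) (psi2 p u).
Proof.
move=> hp; have D0 := D_gt0 u hp.
have h1 := is_derive_D p u.
have Dn0 : D p u != 0 by rewrite gt_eqF.
have h3 := is_deriveV Dn0 h1.
rewrite /psi1 /psi2; apply: is_derive_eq.
rewrite /GRing.scale /= /D; field.
exact: Dn0.
Qed.

(** With [q = p * expR u / D p u], the second derivative is [1/4 - q (1 - q) = (1/2 - q)^2]. *)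
Let psi2_ge0 p u : 0 <= p <= 1 -> 0 <= psi2 p u.
Proof.
move=> hp; have D0 := D_gt0 u hp.
have -> : psi2 p u = ((1 - p - p * expR u) / (2 * D p u)) ^+ 2.
  rewrite /psi2 /D; field.
  exact: lt0r_neq0.
exact: sqr_ge0.
Qed.

Let incr (f df : R -> R) u : (forall x : R, is_derive x 1 f (df x)) ->
  (forall x : R, 0 < x -> 0 <= df x) -> 0 < u -> f 0 <= f u.
Proof.
move=> fd df0 u0.
have cf : {within `[0, u], continuous f}.
  by apply: derivable_within_continuous => x _; have [] := fd x.
have [c] := MVT u0 (fun x _ => fd x) cf.
rewrite in_itv/= => /andP[c0 _] e.
by rewrite -subr_ge0 e mulr_ge0 ?df0// subr0 ltW.
Qed.

Let psi_ge0 p u : 0 <= p <= 1 -> 0 < u -> 0 <= psi p u.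
Proof.
move=> hp u0.
have <- : psi p 0 = 0.
  by rewrite /psi /D expr2 !mul0r mulr0 expR0 mulr1 subrK ln1; lra.
have psi1_ge0 x : 0 < x -> 0 <= psi1 p x.
  move=> x0; have <- : psi1 p 0 = 0 by rewrite /psi1 /D expR0 mulr1 subrK; lra.
  exact: (incr (fun y => is_derive_psi1 y hp) (fun y _ => psi2_ge0 y hp) x0).
exact: (incr (fun y => is_derive_psi y hp) psi1_ge0 u0).
Qed.

Let two_point_gt0 p u : 0 <= p <= 1 -> 0 < u ->
  1 - p + p * expR u <= expR (p * u + u ^+ 2 / 8).
Proof.
move=> hp u0; have := psi_ge0 hp u0.
rewrite /psi subr_ge0 -ler_expR lnK ?posrE ?D_gt0// => h.
by rewrite [p * u + _]addrC.
Qed.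

Lemma two_point_mgf p u : 0 <= p <= 1 ->
  1 - p + p * expR u <= expR (p * u + u ^+ 2 / 8).
Proof.
move=> hp; have [u0|u0|<-] := ltgtP 0 u.
- exact: two_point_gt0.
(* The inequality for [1 - p] and [- u], multiplied by [expR u], is the one for [p] and [u]. *)
- have hq : 0 <= 1 - p <= 1 by lra.
  have un0 : 0 < - u by lra.
  have := two_point_gt0 hq un0.
  rewrite -(ler_pM2r (expR_gt0 u)) -expRD mulrDl -mulrA -expRD addNr expR0.
  by move=> h; apply: le_trans (le_trans h _); rewrite ?ler_expR; lra.
- by rewrite expR0 mulr1 subrK expr2 !mul0r mulr0 addr0 expR0.
Qed.

(** Case [p = 1/2], [u = 2 y] of the two-point bound, recentred by the factor [expR (- y)]. *)
Lemma cosh_le y : (expR y + expR (- y)) / 2 <= expR (y ^+ 2 / 2).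
Proof.
have h : 0 <= (1 / 2 : R) <= 1 by lra.
have := @two_point_mgf _ (2 * y) h.
rewrite -(ler_pM2r (expR_gt0 (- y))) -expRD.
have -> : 1 / 2 * (2 * y) + (2 * y) ^+ 2 / 8 + - y = y ^+ 2 / 2 by field.
apply: le_trans; rewrite [leRHS]mulrDl -(mulrA (1 / 2)) -expRD.
have -> : 2 * y + - y = y by ring.
by lra.
Qed.

End two_point.

Section rademacher.
Context {R : realType}.
Implicit Types (e : seq bool) (a : seq R) (n : nat).

Definition sgn (b : bool) : R := if b then 1 else -1.

(** Expectation under [n] independent fair signs, as a finite recursion: it needs no probability
    space of signs and unfolds in step with [rade] below. *)
Fixpoint rad_avg n (phi : seq bool -> R) : R :=
  if n is n'.+1 then (rad_avg n' (fun e => phi (true :: e))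
                      + rad_avg n' (fun e => phi (false :: e))) / 2
  else phi [::].

Definition rsum e a : R := \sum_(p <- zip e a) sgn p.1 * p.2.

Lemma rsum_nil e : rsum e [::] = 0.
Proof. by case: e => [|b e]; rewrite /rsum big_nil. Qed.

Lemma rsum_cons b e x a : rsum (b :: e) (x :: a) = sgn b * x + rsum e a.
Proof. by rewrite /rsum big_cons. Qed.

Lemma le_rad_avg n phi psi : (forall e, size e = n -> phi e <= psi e) ->
  rad_avg n phi <= rad_avg n psi.
Proof.
elim: n phi psi => [|n IH] phi psi h /=; first exact: h.
by rewrite ler_pM2r ?invr_gt0//; apply: lerD; apply: IH => e se; apply: h => /=; rewrite se.
Qed.

Lemma eq_rad_avg n phi psi : (forall e, size e = n -> phi e = psi e) ->
  rad_avg n phi = rad_avg n psi.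
Proof.
by move=> h; apply/le_anti/andP; split; apply: le_rad_avg => e /h ->.
Qed.

Lemma rad_avgD n phi psi :
  rad_avg n (fun e => phi e + psi e) = rad_avg n phi + rad_avg n psi.
Proof. by elim: n phi psi => //= n IH phi psi; rewrite !IH; field. Qed.

Lemma rad_avgZ n k phi : rad_avg n (fun e => k * phi e) = k * rad_avg n phi.
Proof. by elim: n phi => //= n IH phi; rewrite !IH; field. Qed.

Lemma rad_avg_cst n k : rad_avg n (fun=> k) = k.
Proof. by elim: n => //= n ->; field. Qed.

Lemma rad_avg_sum n (I : Type) (s : seq I) (F : I -> seq bool -> R) :
  rad_avg n (fun e => \sum_(i <- s) F i e) = \sum_(i <- s) rad_avg n (F i).
Proof.
elim: s => [|i s IH].
  by rewrite big_nil -[RHS](rad_avg_cst n); apply: eq_rad_avg => e _; rewrite big_nil.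
by rewrite big_cons -IH -rad_avgD; apply: eq_rad_avg => e _; rewrite big_cons.
Qed.

(** Independence of the signs factors the average into hyperbolic cosines, each bounded by
    [cosh_le]: a signed sum is sub-Gaussian with variance proxy the sum of squares. *)
Lemma rad_avg_expR lam a :
  rad_avg (size a) (fun e => expR (lam * rsum e a))
    <= expR (lam ^+ 2 / 2 * \sum_(x <- a) x ^+ 2).
Proof.
elim: a => [|x a IH]; first by rewrite /= big_nil mulr0 rsum_nil mulr0.
rewrite [rad_avg _ _]/= big_cons mulrDr expRD.
under eq_rad_avg do rewrite rsum_cons mulrDr expRD.
under [X in _ + X]eq_rad_avg do rewrite rsum_cons mulrDr expRD.
rewrite !rad_avgZ -mulrDl mulrAC; apply: ler_pM => //.
- by rewrite -(rad_avg_cst (size a) 0); apply: le_rad_avg => e _; exact: expR_ge0.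
- rewrite /sgn mul1r mulN1r mulrN; apply: le_trans (cosh_le _) _.
  by rewrite exprMn mulrAC.
Qed.

(** Instead of Jensen and a logarithm, the tangent bound [x <= c - 1 + expR (x - c)] is applied to
    [lam] times the maximum, whose exponential is at most the sum of all the exponentials. The
    condition [1 <= c] keeps the bound nonnegative, as the base value 0 of the maximum requires. *)
Lemma rad_avg_bigmax (I : finType) n (Y : I -> seq bool -> R) (lam V c : R) :
  0 < lam -> 1 <= c -> 2 * #|I|%:R * V <= expR c ->
  (forall i, rad_avg n (fun e => expR (lam * Y i e)) <= V) ->
  (forall i, rad_avg n (fun e => expR (- lam * Y i e)) <= V) ->
  rad_avg n (fun e => \big[Num.max/0]_i `|Y i e|) <= c / lam.
Proof.
move=> lam0 c1 hc hp hm.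
rewrite ler_pdivlMr// mulrC -rad_avgZ.
have := (@le_rad_avg n (fun e => lam * \big[Num.max/0]_i `|Y i e|) (fun e => c - 1 +
   expR (- c) * \sum_i (expR (lam * Y i e) + expR (- lam * Y i e)))).
move=> h; apply: le_trans (h _) _ => {h}.
  move=> e _.
  set S := \sum_i _.
  have S0 : 0 <= S by apply: sumr_ge0 => i _; rewrite addr_ge0// expR_ge0.
  have hS : 0 <= expR (- c) * S by rewrite mulr_ge0 ?expR_ge0.
  rewrite mulrC -ler_pdivlMr//; apply: bigmax_le.
    by rewrite divr_ge0 ?(ltW lam0)//; lra.
  move=> i _; rewrite ler_pdivlMr// mulrC.
  have ex : expR (lam * `|Y i e|) <= S.
    rewrite /S (bigD1 i)//= ler_wpDr//.
      by apply: sumr_ge0 => j _; rewrite addr_ge0// expR_ge0.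
    have e0 := expR_ge0 (lam * Y i e); have e1 := expR_ge0 (- lam * Y i e).
    case: (ler0P (Y i e)) => _; last by lra.
    by rewrite mulrN -mulNr; lra.
  have := expR_ge1Dx (lam * `|Y i e| - c).
  rewrite addrC expRD => h.
  have : expR (lam * `|Y i e|) * expR (- c) <= expR (- c) * S.
    by rewrite mulrC ler_pM2l ?expR_gt0.
  by lra.
rewrite rad_avgD rad_avg_cst rad_avgZ rad_avg_sum.
have : \sum_(i : I) rad_avg n (fun e => expR (lam * Y i e) + expR (- lam * Y i e))
    <= \sum_(i : I) 2 * V.
  by apply: ler_sum => i _; rewrite rad_avgD; have := hp i; have := hm i; lra.
rewrite big_const iter_addr_0 -[_ *+ _]mulr_natr => h1.
have h2 : expR (- c) * \sum_(i : I) rad_avg n (fun e => expR (lam * Y i e) + expR (- lam * Y i e)) <= 1.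
  rewrite -(@ler_pM2l _ (expR c)) ?expR_gt0// mulrA -expRD subrr expR0 mul1r mulr1.
  by apply: le_trans hc; apply: le_trans h1 _; rewrite mulrAC.
by lra.
Qed.

End rademacher.

(** * Dyadic chaining over orthants *)

Section chaining.
Context {R : realType}.
Implicit Types (e : seq bool) (rs : seq (nat * nat)).

Definition orthant (i j : nat) (p : nat * nat) : bool := (p.1 < i)%N && (p.2 < j)%N.

Definition osum rs e (i j : nat) : R := rsum e [seq (orthant i j p)%:R | p <- rs].

Lemma rsumB (T : Type) e (s : seq T) (f g : T -> R) :
  rsum e [seq f p | p <- s] - rsum e [seq g p | p <- s] = rsum e [seq f p - g p | p <- s].
Proof.
elim: s e => [|x s IH] [|b e]; rewrite /= ?rsum_nil ?subr0//.
  by rewrite /rsum !big_nil subr0.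
by rewrite !rsum_cons -IH; ring.
Qed.

Lemma uniq_count_itv (s : seq nat) (i j : nat) : uniq s ->
  (count (fun x => i <= x < j)%N s <= j - i)%N.
Proof.
move=> us; rewrite -size_filter -(size_iota i (j - i)).
apply: uniq_leq_size; first exact: filter_uniq.
by move=> x; rewrite mem_filter mem_iota => /andP[/andP[h1 h2] _]; lia.
Qed.

(** Two orthants whose corners differ by at most [d] in each coordinate disagree only inside a
    vertical and a horizontal strip of width [d]. As the ranks are distinct, each strip holds at
    most [d] points. *)
Lemma osum_increment_sqr rs (i j i' j' d : nat) :
  uniq (map fst rs) -> uniq (map snd rs) ->
  (i' <= i <= i' + d)%N -> (j' <= j <= j' + d)%N ->
  \sum_(x <- [seq (orthant i j p)%:R - (orthant i' j' p)%:R | p <- rs]) x ^+ 2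
    <= 2 * d%:R :> R.
Proof.
move=> u1 u2 /andP[i1 i2] /andP[j1 j2]; rewrite big_map.
have h1 := uniq_count_itv i' i u1; have h2 := uniq_count_itv j' j u2.
have : \sum_(p <- rs) ((orthant i j p)%:R - (orthant i' j' p)%:R) ^+ 2
   <= \sum_(p <- rs) (((i' <= p.1 < i)%N : nat) + ((j' <= p.2 < j)%N : nat))%:R :> R.
  apply: ler_sum => -[a b] _; rewrite /orthant /=.
  have [h3|h3] := ltnP a i; have [h4|h4] := ltnP b j;
  have [h5|h5] := ltnP a i'; have [h6|h6] := ltnP b j' => //=;
  rewrite ?subr0 ?subrr ?expr0n ?expr1n ?ler0n ?ler1n//; lia.
move=> h; apply: le_trans h _.
rewrite -natr_sum -natrM ler_nat big_split /=.
have e1 (f : nat * nat -> bool) : (\sum_(p <- rs) f p = count f rs)%N.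
  by rewrite -sum1_count [RHS]big_mkcond; apply: eq_bigr => p _; case: (f p).
rewrite !e1; rewrite count_map in h1; rewrite count_map in h2.
rewrite mul2n -addnn; apply: leq_add; [apply: leq_trans h1 _|apply: leq_trans h2 _]; lia.
Qed.

(** Level [k] of the chain uses corners on the mesh [2 ^ (m - k)]: only the empty orthant at level
    0, all corners below [2 ^ m] at level [m]. The links in [grid_step] join a corner to the one
    obtained by rounding down to the coarser mesh. *)
Definition grid_max rs m k e : R :=
  \big[Num.max/0]_(p : 'I_(2 ^ k) * 'I_(2 ^ k))
    `|osum rs e (p.1 * 2 ^ (m - k)) (p.2 * 2 ^ (m - k))|.

Definition grid_step rs m k e : R :=
  \big[Num.max/0]_(p : 'I_(2 ^ k.+1) * 'I_(2 ^ k.+1))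
    `|osum rs e (p.1 * 2 ^ (m - k.+1)) (p.2 * 2 ^ (m - k.+1))
      - osum rs e (p.1./2 * 2 ^ (m - k)) (p.2./2 * 2 ^ (m - k))|.

Lemma grid_max0 rs m e : grid_max rs m 0 e = 0.
Proof.
apply/le_anti/andP; split; last exact: bigmax_ge_id.
apply: bigmax_le => // -[i j] _ /=.
rewrite !ord1 /= !mul0n /osum /orthant.
have -> : [seq ((p.1 < 0)%N && (p.2 < 0)%N)%:R | p <- rs] = [seq (0:R) | p <- rs] by [].
suff -> : rsum e [seq (0:R) | p <- rs] = 0 by rewrite normr0.
elim: rs e => [|p rs IH] [|b e] /=; rewrite ?rsum_nil//; first by rewrite /rsum big_nil.
by rewrite rsum_cons IH mulr0 addr0.
Qed.

Lemma grid_maxS rs m k e : grid_max rs m k.+1 e <= grid_max rs m k e + grid_step rs m k e.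
Proof.
apply: bigmax_le => [|[i j] _ /=].
  by apply: addr_ge0; exact: bigmax_ge_id.
have hh x : (x < 2 ^ k.+1)%N -> (x./2 < 2 ^ k)%N.
  by rewrite expnS mul2n ltn_half_double.
have hi := hh _ (ltn_ord i); have hj := hh _ (ltn_ord j).
rewrite -[X in `|X|](subrK (osum rs e (i./2 * 2 ^ (m - k)) (j./2 * 2 ^ (m - k)))).
apply: le_trans (ler_normD _ _) _; rewrite addrC; apply: lerD.
  exact: (le_bigmax _ (fun p : 'I_(2 ^ k) * 'I_(2 ^ k) =>
    `|osum rs e (p.1 * 2 ^ (m - k)) (p.2 * 2 ^ (m - k))|) (Ordinal hi, Ordinal hj)).
exact: (le_bigmax _ (fun p : 'I_(2 ^ k.+1) * 'I_(2 ^ k.+1) =>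
    `|osum rs e (p.1 * 2 ^ (m - k.+1)) (p.2 * 2 ^ (m - k.+1))
      - osum rs e (p.1./2 * 2 ^ (m - k)) (p.2./2 * 2 ^ (m - k))|) (i, j)).
Qed.

(** The rational bound [ln 2 <= 3/4], used to absorb the cardinality of a grid into an exponent. It
    holds because 1.15 to the fifth power already exceeds 2. *)
Lemma expR34_ge2 : 2 <= expR (3 / 4 : R).
Proof.
have -> : 3 / 4 = 5%:R * (3 / 20) :> R by field.
rewrite expRM_natl; apply: (@le_trans _ _ ((1 + 3 / 20) ^+ 5)); first by lra.
by apply: lerXn2r; rewrite ?nnegrE ?expR_ge0 ?expR_ge1Dx//; lra.
Qed.

(** Maximal inequality over [2 ^ (2 k + 2)] links, each of variance proxy [2 ^ (m - k)]. The
    variable [s] stands for the square root of 2, so that half-integer powers of 2 become ordinary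
    powers. *)
Lemma rad_avg_grid_step rs m k (s : R) : 0 < s -> s ^+ 2 = 2 -> (k < m)%N ->
  uniq (map fst rs) -> uniq (map snd rs) ->
  rad_avg (size rs) (grid_step rs m k) <= (k%:R + 7 / 2) * s ^+ (m - k.+1).
Proof.
move=> s0 s2 km u1 u2.
set t := s ^+ (m - k.+1); have t0 : 0 < t by rewrite exprn_gt0.
(* The increments have variance proxy [2 t^2]; this [lam] turns it into the exponent [(k + 2)^2]. *)
pose lam : R := (k%:R + 2) / t.
have k0 : 0 <= k%:R :> R by [].
have lam0 : 0 < lam by rewrite divr_gt0//; lra.
(* The exponent [(k + 2)^2] plus the logarithm of [2 ^ (2 k + 3)], twice the number of links, with
   [3/4] in place of [ln 2]. *)
pose c : R := (k%:R + 2) ^+ 2 + 3 / 4 * (2 * k%:R + 3).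
have c1 : 1 <= c by rewrite /c; nra.
have card : 2 * #|{: 'I_(2 ^ k.+1) * 'I_(2 ^ k.+1)}|%:R * expR ((k%:R + 2) ^+ 2) <= expR c.
  rewrite /c expRD [leRHS]mulrC ler_pM2r ?expR_gt0// card_prod !card_ord -expnD.
  have -> : 2 * (2 ^ (k.+1 + k.+1))%:R = 2 ^+ (2 * k + 3) :> R.
    by rewrite natrX -exprS; congr (_ ^+ _); lia.
  have -> : 3 / 4 * (2 * k%:R + 3) = (2 * k + 3)%:R * (3 / 4) :> R.
    by rewrite natrD natrM mulrC.
  rewrite expRM_natl; apply: lerXn2r; rewrite ?nnegrE ?expR_ge0//.
  exact: expR34_ge2.
have mgf i j i' j' (l : R) : l ^+ 2 = lam ^+ 2 ->
   (i' <= i <= i' + 2 ^ (m - k.+1))%N -> (j' <= j <= j' + 2 ^ (m - k.+1))%N ->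
   rad_avg (size rs) (fun e => expR (l * (osum rs e i j - osum rs e i' j'))) <= expR ((k%:R + 2) ^+ 2).
  move=> hl hi hj.
  under eq_rad_avg do rewrite /osum rsumB.
  have := rad_avg_expR l [seq (orthant i j p)%:R - (orthant i' j' p)%:R | p <- rs].
  rewrite size_map => h; apply: le_trans h _; rewrite ler_expR hl.
  have := osum_increment_sqr u1 u2 hi hj.
  have -> : (2 ^ (m - k.+1))%:R = t ^+ 2 :> R.
    by rewrite /t -exprM mulnC exprM s2 natrX.
  set S := \sum_(_ <- _) _ => hS.
  have -> : (k%:R + 2) ^+ 2 = lam ^+ 2 / 2 * (2 * t ^+ 2) :> R.
    by rewrite /lam; field; rewrite gt_eqF.
  by rewrite ler_wpM2l// mulr_ge0 ?sqr_ge0.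
have hh (i : nat) : (i./2 * 2 ^ (m - k) <= i * 2 ^ (m - k.+1) <= i./2 * 2 ^ (m - k) + 2 ^ (m - k.+1))%N.
  have -> : (m - k = (m - k.+1).+1)%N by lia.
  have := odd_double_half i; set h := i./2; set T := (2 ^ (m - k.+1))%N.
  by rewrite expnS -/T; case: (odd i) => /= <-; rewrite -mul2n; nia.
have := @rad_avg_bigmax _ _ (size rs) (fun (p : 'I_(2 ^ k.+1) * 'I_(2 ^ k.+1)) e =>
   osum rs e (p.1 * 2 ^ (m - k.+1)) (p.2 * 2 ^ (m - k.+1))
      - osum rs e (p.1./2 * 2 ^ (m - k)) (p.2./2 * 2 ^ (m - k))) lam _ c lam0 c1 card.
move=> h; apply: le_trans (h _ _) _ => {h}.
- by move=> p; apply: mgf => //; exact: hh.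
- by move=> p; apply: mgf; rewrite ?sqrrN//; exact: hh.
(* The bound [c / lam] is [t] times [(k + 2) + 3/4 (2 k + 3) / (k + 2)], and the second term is
   below [3/2]. *)
rewrite /lam /c invf_div mulrA ler_pdivrMr; last by lra.
rewrite [leRHS]mulrAC ler_pM2r//; nra.
Qed.

(** Sum of the links in closed form. The coefficient [s + 1] is the inverse of [s - 1], which
    matches the terms in [k]; the constant terms then require at least [(s + 1) (s + 9/2)], about
    14.28, whence [143/10]. *)
Lemma rad_avg_grid_max rs m k (s : R) : 0 < s -> s ^+ 2 = 2 -> (k <= m)%N ->
  uniq (map fst rs) -> uniq (map snd rs) ->
  rad_avg (size rs) (grid_max rs m k) <= (143 / 10) * s ^+ m - ((s + 1) * k%:R + (143 / 10)) * s ^+ (m - k).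
Proof.
move=> s0 s2 + u1 u2; elim: k => [_|k IH km].
  rewrite (eq_rad_avg (psi := fun=> 0)); last by move=> e _; rewrite grid_max0.
  by rewrite rad_avg_cst subn0 mulr0 add0r subrr.
apply: (@le_trans _ _ (rad_avg (size rs) (fun e => grid_max rs m k e + grid_step rs m k e))).
  by apply: le_rad_avg => e _; exact: grid_maxS.
rewrite rad_avgD; have h1 := IH (ltnW km); have h2 := rad_avg_grid_step s0 s2 km u1 u2.
apply: le_trans (lerD h1 h2) _.
have -> : (m - k = (m - k.+1).+1)%N by lia.
rewrite exprS; set t := s ^+ (m - k.+1).
have t0 : 0 < t by rewrite exprn_gt0.
have k0 : 0 <= k%:R :> R by [].
have sl : 1414 / 1000 < s by nra.
have su : s < 142 / 100 by nra.
rewrite -addrA lerD2l -natr1.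
suff : 0 <= (((s + 1) * k%:R + 143 / 10) * s - (k%:R + 7 / 2)
            - ((s + 1) * (k%:R + 1) + 143 / 10)) * t by lra.
apply: mulr_ge0; last exact: ltW.
have -> : (((s + 1) * k%:R + 143 / 10) * s - (k%:R + 7 / 2)
            - ((s + 1) * (k%:R + 1) + 143 / 10)) =
          (s ^+ 2 - 2) * k%:R + (143 / 10 * s - 7 / 2 - (s + 1) - 143 / 10) by ring.
by rewrite s2; nra.
Qed.

Lemma rad_avg_orthants rs m (s : R) : 0 < s -> s ^+ 2 = 2 ->
  uniq (map fst rs) -> uniq (map snd rs) ->
  rad_avg (size rs) (grid_max rs m m) <= 143 / 10 * s ^+ m.
Proof.
move=> s0 s2 u1 u2; have := rad_avg_grid_max s0 s2 (leqnn m) u1 u2.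
rewrite subnn expr0 mulr1 => h; apply: le_trans h _.
have : 0 <= m%:R :> R by []. nra.
Qed.

End chaining.

(** * From rectangles to orthants of ranks *)

Section ranks.
Context {R : realType}.
Implicit Types xs : seq R.

(** Ranks count predecessors, with ties broken by position, so they stay distinct even when atoms of
    the measure produce equal coordinates. A down-closed predicate contains all values equal to one
    of its members, hence is a rank threshold: the number of entries that satisfy it. *)
Lemma rank_exists xs : exists r : nat -> nat,
  uniq [seq r l | l <- iota 0 (size xs)] /\
  forall D : pred R, (forall x y, y <= x -> D x -> D y) ->
  exists2 i, (i <= size xs)%N & forall l, (l < size xs)%N -> D (nth 0 xs l) = (r l < i)%N.
Proof.
set n := size xs; pose x l := nth 0 xs l.
pose lt l' l := (x l' < x l) || ((x l' == x l) && (l' < l)%N).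
have lt_irr l : ~~ lt l l by rewrite /lt ltxx ltnn andbF.
have lt_trans l2 l1 l3 : lt l1 l2 -> lt l2 l3 -> lt l1 l3.
  rewrite /lt => /orP[h1|/andP[/eqP e1 h1]] /orP[h2|/andP[/eqP e2 h2]].
  - by rewrite (Order.POrderTheory.lt_trans h1 h2).
  - by rewrite -e2 h1.
  - by rewrite e1 h2.
  - by rewrite e1 e2 eqxx (ltn_trans h1 h2) orbT.
have lt_tot l l' : l != l' -> lt l l' || lt l' l.
  by rewrite /lt; case: (ltgtP (x l) (x l')) => //= _; case: (ltngtP l l').
have cnt a l : (l < n)%N -> count a (iota 0 n) = (a l + count a (rem l (iota 0 n)))%N.
  by move=> ln; have /permP -> : perm_eq (iota 0 n) (l :: rem l (iota 0 n));
    rewrite ?perm_to_rem ?mem_iota.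
pose r l := count (lt^~ l) (iota 0 n).
have lt_rank l l' : (l < n)%N -> lt l l' -> (r l < r l')%N.
  move=> ln ll'; rewrite /r.
  rewrite (cnt (lt^~ l') l)// ll' (cnt _ l)// (negbTE (lt_irr l)) add0n add1n ltnS.
  by apply: sub_count => k /lt_trans; apply.
exists r; split.
  rewrite map_inj_in_uniq ?iota_uniq// => l l'; rewrite !mem_iota /= !add0n => ln l'n e.
  apply/eqP; apply: contraT => /lt_tot /orP[] /lt_rank.
    by move=> /(_ ln); rewrite e ltnn.
  by move=> /(_ l'n); rewrite e ltnn.
move=> D Dd; exists (count (D \o x) (iota 0 n)).
  by apply: leq_trans (count_size _ _) _; rewrite size_iota.
move=> l ln.
case: (boolP (D (nth 0 xs l))) => Dl; apply/esym; last first.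
  apply/negbTE; rewrite -leqNgt; apply: sub_count => k /= Dk.
  rewrite /lt; have [//|le] := ltP (x k) (x l).
  by exfalso; move/negP: Dl; apply; exact: Dd le Dk.
rewrite /r (cnt (lt^~ l) l)// (negbTE (lt_irr l)) (cnt _ l)//= Dl add0n add1n ltnS.
apply: sub_count => k /orP[h|/andP[/eqP h _]] /=; first exact: Dd (ltW h) Dl.
by rewrite h.
Qed.

Definition in_rect (q : (R * R) * (R * R)) (z : R * R) : bool :=
  (q.1.1 <= z.1 <= q.1.2) && (q.2.1 <= z.2 <= q.2.2).

(** The inequality [n < 2 ^ m] is strict because thresholds run from 0 to [n] included and must all
    be grid coordinates. The least such [m] costs a factor [sqrt 2] at most. *)
Lemma sqrt_pow2_le n : (0 < n)%N -> exists2 m, (n < 2 ^ m)%N &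
  Num.sqrt 2 ^+ m <= Num.sqrt 2 * Num.sqrt n%:R :> R.
Proof.
move=> n0; exists (trunc_log 2 n).+1; first exact: trunc_log_ltn.
rewrite exprS ler_pM2l ?sqrtr_gt0//.
rewrite -(@ler_pXn2r _ 2)// ?nnegrE ?exprn_ge0 ?sqrtr_ge0//.
by rewrite -exprM mulnC exprM !sqr_sqrtr// -natrX ler_nat trunc_logP.
Qed.

(* Passing to ranks turns rectangles into differences of orthants of a
   permutation of [n] points. *)
Lemma rad_avg_rectangles (zs : seq (R * R)) : (0 < size zs)%N ->
  exists2 B : seq bool -> R, rad_avg (size zs) B <= 87 * Num.sqrt (size zs)%:R &
  forall q e, `|rsum e [seq (in_rect q p)%:R | p <- zs]| <= B e.
Proof.
move=> n0; set n := size zs in n0 *.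
have [m nm hm] := sqrt_pow2_le n0.
have [r1 [u1 h1]] := rank_exists (map fst zs).
have [r2 [u2 h2]] := rank_exists (map snd zs).
rewrite !size_map -/n in u1 h1 u2 h2.
pose rs := [seq (r1 l, r2 l) | l <- iota 0 n].
have srs : size rs = n by rewrite size_map size_iota.
have s0 : 0 < Num.sqrt 2 :> R by rewrite sqrtr_gt0.
have s2 : Num.sqrt 2 ^+ 2 = 2 :> R by rewrite sqr_sqrtr.
(* Four orthants per rectangle by inclusion-exclusion; [4 * 14.3 * 1.42] is about 81.2, below 87. *)
exists (fun e => 4 * grid_max rs m m e).
  rewrite rad_avgZ -srs.
  have := @rad_avg_orthants R rs m _ s0 s2.
  rewrite -2!map_comp => /(_ u1 u2) => h.
  apply: (@le_trans _ _ (4 * (143 / 10 * (Num.sqrt 2 * Num.sqrt n%:R)))).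
    rewrite ler_pM2l//; apply: le_trans h _.
    by rewrite ler_pM2l.
  rewrite srs !mulrA ler_wpM2r ?sqrtr_ge0//.
  have : Num.sqrt 2 < 142 / 100 :> R by nra.
  by lra.
move=> [[a b] [c d]] e.
have [i2 i2n hi2] := h1 (fun x => x <= b) (fun x y yx xb => le_trans yx xb).
(* The conjunct [x <= b] makes the difference of the two down-sets equal to the interval from [a] to
   [b] even when [b < a]. *)
have [i1 i1n hi1] := h1 (fun x => (x <= b) && (x < a))
  (fun x y yx xb => let: conj u v := andP xb in introT andP (conj (le_trans yx u) (le_lt_trans yx v))).
have [j2 j2n hj2] := h2 (fun x => x <= d) (fun x y yx xb => le_trans yx xb).
have [j1 j1n hj1] := h2 (fun x => (x <= d) && (x < c))
  (fun x y yx xb => let: conj u v := andP xb in introT andP (conj (le_trans yx u) (le_lt_trans yx v))).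
have -> : rsum e [seq (in_rect ((a, b), (c, d)) p)%:R | p <- zs] =
   osum rs e i2 j2 - osum rs e i1 j2 - (osum rs e i2 j1 - osum rs e i1 j1) :> R.
  rewrite /osum !rsumB; congr rsum.
  rewrite -[in LHS](mkseq_nth (0, 0) zs) -/n /mkseq /rs -!map_comp.
  apply/eq_in_map => l; rewrite mem_iota /= add0n => ln.
  rewrite /orthant /in_rect /= -hi2// -hi1// -hj2// -hj1//.
  rewrite !(nth_map (0, 0))//.
  set z := nth _ zs l; case: (leP z.1 b); case: (leP a z.1);
    case: (leP z.2 d); case: (leP c z.2) => //= *; by ring.
have bd i j : (i <= n)%N -> (j <= n)%N -> `|osum rs e i j : R| <= grid_max rs m m e.
  move=> /leq_ltn_trans/(_ nm) im /leq_ltn_trans/(_ nm) jm.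
  have <- : osum rs e (i * 2 ^ (m - m)) (j * 2 ^ (m - m)) = osum rs e i j :> R.
    by rewrite subnn expn0 !muln1.
  rewrite /grid_max; apply: (le_bigmax (0:R) (fun p : 'I_(2 ^ m) * 'I_(2 ^ m) =>
    `|osum rs e (p.1 * 2 ^ (m - m)) (p.2 * 2 ^ (m - m))|) (Ordinal im, Ordinal jm)).
have b1 := bd _ _ i2n j2n; have b2 := bd _ _ i1n j2n.
have b3 := bd _ _ i2n j1n; have b4 := bd _ _ i1n j1n.
apply: le_trans (ler_normB _ _) _.
apply: le_trans (lerD (ler_normB _ _) (ler_normB _ _)) _.
move: b1 b2 b3 b4; move: (grid_max _ _ _ _) (`|_|) (`|_|) (`|_|) (`|_|).
by move=> *; lra.
Qed.

End ranks.

(** * Iterated integrals *)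

Section lower_integral.
Context d (T : measurableType d) (R : realType).
Local Open Scope ereal_scope.
Implicit Types f g : T -> \bar R.
Import HBNNSimple.

(** Simple functions only see measurable level sets. This allows the bare set function
    [grapheur_measure] to be replaced under the integral by a genuine measure that agrees with it on
    measurable sets. *)
Lemma eq_set_function_integral (m1 m2 : set T -> \bar R) f :
  (forall A, measurable A -> m1 A = m2 A) -> \int[m1]_x f x = \int[m2]_x f x.
Proof.
move=> m12.
have e (h : {nnsfun T >-> R}) : sintegral m1 h = sintegral m2 h.
  by rewrite !sintegralET; apply: eq_fsbigr => x _; rewrite m12.
rewrite /integral; congr (_ - _); congr ereal_sup; apply/seteqP;
  by split=> _ [h ? <-]; exists h.
Qed.

(* No measurability is needed: the integral of a nonnegative function is its lower integral. *)
Lemma le_lower_integral (mu : {measure set T -> \bar R}) f g :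
  (forall x, 0 <= f x) -> (forall x, f x <= g x) -> \int[mu]_x f x <= \int[mu]_x g x.
Proof.
move=> f0 fg; rewrite !ge0_integralTE//; last by move=> x; exact: le_trans (f0 x) (fg x).
apply: le_ereal_sup => _ [h hf <-]; exists h => // x.
exact: le_trans (hf x) (fg x).
Qed.

End lower_integral.

Section iterated_integral.
Context (R : realType).
Local Open Scope ereal_scope.

(** [iid_integral] over an arbitrary space: it will be used for edges, for types and for codes. *)
Fixpoint iint d (Z : measurableType d) (mu : set Z -> \bar R) (k : nat)
    (F : seq Z -> \bar R) : \bar R :=
  if k is k'.+1 then \int[mu]_z iint mu k' (fun s => F (z :: s)) else F [::].

Lemma iid_integralE (m : set (measurableTypeR R * measurableTypeR R) -> \bar R) k F :
  iid_integral m k F = iint m k F.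
Proof.
elim: k F => //= k IH F; congr (integral _ _ _).
by apply/funext => z; rewrite IH.
Qed.

Lemma eq_set_function_iint d (Z : measurableType d) (m1 m2 : set Z -> \bar R) k F :
  (forall A, measurable A -> m1 A = m2 A) -> iint m1 k F = iint m2 k F.
Proof.
move=> m12; elim: k F => //= k IH F.
rewrite (eq_set_function_integral _ m12); congr (integral _ _ _).
by apply/funext => z; exact: IH.
Qed.

Lemma mkseqS (T : Type) (f : nat -> T) k : mkseq f k.+1 = f 0%N :: mkseq (f \o S) k.
Proof. by rewrite /mkseq /= (iotaDl 1 0) -map_comp. Qed.

(* Joint measurability in a parameter and [k] entries, tested on generic measurable elements. *)
Definition mseq dX (X : measurableType dX) dZ (Z : measurableType dZ) (k : nat)
    (F : X -> seq Z -> \bar R) : Prop :=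
  forall dY (Y : measurableType dY) (g : Y -> X) (zs : nat -> Y -> Z),
    measurable_fun setT g -> (forall i, measurable_fun setT (zs i)) ->
    measurable_fun setT (fun y => F (g y) (mkseq (zs^~ y) k)).

Section props.
Context dX (X : measurableType dX) dZ (Z : measurableType dZ).
Implicit Types (F : X -> seq Z -> \bar R).

Lemma mseq_comp dX' (X' : measurableType dX') (h : X' -> X) k F :
  measurable_fun setT h -> mseq k F -> mseq k (fun x => F (h x)).
Proof. by move=> mh mF dY Y g zs mg mzs; apply: mF => //; exact: measurableT_comp. Qed.

Lemma mseq_cons dX' (X' : measurableType dX') (h : X' -> X) (h' : X' -> Z) k F :
  measurable_fun setT h -> measurable_fun setT h' ->
  mseq k.+1 F -> mseq k (fun x s => F (h x) (h' x :: s)).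
Proof.
move=> mh mh' mF dY Y g zs mg mzs.
have := mF _ Y (h \o g) (fun i => if i is j.+1 then zs j else h' \o g).
move=> /(_ (measurableT_comp mh mg)) H.
under eq_fun.
  move=> y; have -> : h' (g y) :: mkseq (zs^~ y) k =
    mkseq ((fun i => if i is j.+1 then zs j else h' \o g)^~ y) k.+1 by rewrite mkseqS.
  over.
by apply: H => -[|i] //; exact: measurableT_comp.
Qed.

Lemma mseq0 F : mseq 0 F -> measurable_fun setT (fun x => F x [::]).
Proof.
move=> mF; have m (i : nat) : measurable_fun setT ((fun=> cst point) i : X -> Z).
  exact: measurable_cst.
exact: (mF _ X idfun (fun=> cst point) (@measurable_id _ X setT) m).
Qed.

End props.

Section iint_measure.
Context dZ (Z : measurableType dZ) (mu : {measure set Z -> \bar R}).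
Implicit Types (F G : seq Z -> \bar R).

Lemma iint_ge0 k F : (forall s, 0 <= F s) -> 0 <= iint mu k F.
Proof.
elim: k F => //= k IH F F0; apply: integral_ge0 => z _.
by apply: IH => s; exact: F0.
Qed.

Lemma le_iint k F G : (forall s, size s = k -> 0 <= F s) ->
  (forall s, size s = k -> F s <= G s) -> iint mu k F <= iint mu k G.
Proof.
elim: k F G => /= [|k IH] F G F0 FG; first exact: FG.
apply: le_lower_integral => z; last first.
  by apply: IH => s ss; [apply: F0|apply: FG]; rewrite /= ss.
suff : iint mu k (fun=> 0) <= iint mu k (fun s => F (z :: s)).
  by apply: le_trans; apply: iint_ge0.
by apply: IH => // s ss; apply: F0; rewrite /= ss.
Qed.

Lemma eq_iint k F G : (forall s, size s = k -> F s = G s) -> iint mu k F = iint mu k G.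
Proof.
elim: k F G => /= [|k IH] F G FG; first exact: FG.
by apply: eq_integral => z _; apply: IH => s ss; apply: FG; rewrite /= ss.
Qed.

End iint_measure.

Section iint_probability.
Context dZ (Z : measurableType dZ) (mu : probability Z R).

Lemma integral_probability_cst (c : \bar R) : \int[mu]_z c = c.
Proof.
have -> : \int[mu]_z c = c * mu setT := integral_cst mu (@measurableT _ Z) c.
have -> : mu setT = 1 := probability_setT mu.
exact: mule1.
Qed.

Lemma iint_cst k (c : \bar R) : iint mu k (fun=> c) = c.
Proof. by elim: k => //= k IH; rewrite IH integral_probability_cst. Qed.

Lemma measurable_iint dX (X : measurableType dX) k (F : X -> seq Z -> \bar R) :
  (forall x s, 0 <= F x s) -> mseq k F -> measurable_fun setT (fun x => iint mu k (F x)).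
Proof.
elim: k dX X F => [|k IH] dX X F F0 mF /=; first exact: mseq0.
pose G (p : X * Z) := iint mu k (fun s => F p.1 (p.2 :: s)).
have mG : measurable_fun setT G.
  apply: IH => [p s|]; first exact: F0.
  exact: (mseq_cons measurable_fst measurable_snd mF).
apply: (@measurable_fun_fubini_tonelli_F _ _ _ _ _ mu G) => //.
by move=> p; apply: iint_ge0 => s; exact: F0.
Qed.

Lemma iint_swap dX (X : measurableType dX) (P : probability X R) k (F : X -> seq Z -> \bar R) :
  (forall x s, 0 <= F x s) -> mseq k F ->
  \int[P]_x iint mu k (F x) = iint mu k (fun s => \int[P]_x F x s).
Proof.
elim: k F => //= k IH F F0 mF.
pose G (p : X * Z) := iint mu k (fun s => F p.1 (p.2 :: s)).
have mG : measurable_fun setT G.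
  apply: measurable_iint => [p s|]; first exact: F0.
  exact: (mseq_cons measurable_fst measurable_snd mF).
have G0 p : 0 <= G p by apply: iint_ge0 => s; exact: F0.
have -> := @fubini_tonelli _ _ _ _ _ P mu G mG G0.
apply: eq_integral => z _; rewrite IH//.
exact: (@mseq_cons _ X _ Z _ X idfun (cst z) k F (@measurable_id _ X setT) (@measurable_cst _ _ X Z setT z) mF).
Qed.

Lemma iintD k (F G : seq Z -> \bar R) : (forall s, 0 <= F s) -> (forall s, 0 <= G s) ->
  mseq k (fun _ : unit => F) -> mseq k (fun _ : unit => G) ->
  iint mu k (fun s => F s + G s) = iint mu k F + iint mu k G.
Proof.
elim: k F G => //= k IH F G F0 G0 mF mG.
rewrite -ge0_integralD//.
- apply: eq_integral => z _; apply: IH => //.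
  + exact: (@mseq_cons _ unit _ Z _ unit idfun (cst z) k (fun=> F) (@measurable_id _ unit setT) (@measurable_cst _ _ unit Z setT z) mF).
  + exact: (@mseq_cons _ unit _ Z _ unit idfun (cst z) k (fun=> G) (@measurable_id _ unit setT) (@measurable_cst _ _ unit Z setT z) mG).
- by move=> z _; apply: iint_ge0.
- have m := @mseq_cons _ unit _ Z _ Z (cst tt) idfun k (fun=> F) (@measurable_cst _ _ Z unit setT tt) (@measurable_id _ Z setT) mF.
  exact: measurable_iint m.
- by move=> z _; apply: iint_ge0.
- have m := @mseq_cons _ unit _ Z _ Z (cst tt) idfun k (fun=> G) (@measurable_cst _ _ Z unit setT tt) (@measurable_id _ Z setT) mG.
  exact: measurable_iint m.
Qed.

Lemma iintZ k (x : R) (F : seq Z -> \bar R) : (0 <= x)%R -> (forall s, 0 <= F s) ->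
  mseq k (fun _ : unit => F) -> iint mu k (fun s => x%:E * F s) = x%:E * iint mu k F.
Proof.
move=> x0; elim: k F => //= k IH F F0 mF.
rewrite -ge0_integralZl_EFin//.
- apply: eq_integral => z _; apply: IH => //.
  exact: (@mseq_cons _ unit _ Z _ unit idfun (cst z) k (fun=> F) (@measurable_id _ unit setT) (@measurable_cst _ _ unit Z setT z) mF).
- by move=> z _; apply: iint_ge0.
- have m := @mseq_cons _ unit _ Z _ Z (cst tt) idfun k (fun=> F) (@measurable_cst _ _ Z unit setT tt) (@measurable_id _ Z setT) mF.
  exact: measurable_iint m.
Qed.

Lemma mseq_int dX (X : measurableType dX) dY (Y : measurableType dY) k
    (F : X -> seq Y -> Z -> \bar R) :
  (forall x s z, 0 <= F x s z) ->
  mseq k (fun (p : X * Z) s => F p.1 s p.2) ->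
  mseq k (fun x s => \int[mu]_z F x s z).
Proof.
move=> F0 mF dW W g ys mg mys.
apply: (@measurable_fun_fubini_tonelli_F _ _ W Z _ mu
  (fun p : W * Z => F (g p.1) (mkseq (ys^~ p.1) k) p.2)) => //.
have m1 : measurable_fun setT (fun p : W * Z => (g p.1, p.2)).
  apply: measurable_fun_pair; last exact: measurable_snd.
  exact: measurableT_comp mg measurable_fst.
have m2 i : measurable_fun setT (fun p : W * Z => ys i p.1).
  exact: measurableT_comp (mys i) measurable_fst.
exact: (mF _ _ _ _ m1 m2).
Qed.

End iint_probability.
End iterated_integral.

(** * McDiarmid's inequality on a discrete space *)

Section mcdiarmid.
Context (R : realType) d (C : measurableType d) (rho : probability C R).
(** Edge types satisfy this, being countably many; the conditional means in the induction below are
    then automatically measurable. *)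
Hypothesis measurable_all : forall A : set C, measurable A.

Let mall d' (T' : sigmaRingType d') (f : C -> T') : measurable_fun setT f.
Proof. by move=> _ Y _; exact: measurable_all. Qed.

(** Convexity from the tangent at the intermediate point [x0], which lies below the exponential at
    both ends of the chord. *)
Lemma expR_chord (lam a c q : R) : 0 <= q <= 1 ->
  expR (lam * (a + q * c)) <= (1 - q) * expR (lam * a) + q * expR (lam * (a + c)).
Proof.
move=> /andP[q0 q1]; set x0 := lam * (a + q * c).
have e0 := expR_gt0 x0.
have tan x : expR x0 * (1 + (x - x0)) <= expR x.
  have -> : expR x = expR x0 * expR (x - x0) by rewrite -expRD addrC subrK.
  by rewrite ler_pM2l// expR_ge1Dx.
have h1 : 0 <= (1 - q) * (expR (lam * a) - expR x0 * (1 + (lam * a - x0))).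
  by rewrite mulr_ge0 ?subr_ge0.
have h2 : 0 <= q * (expR (lam * (a + c)) - expR x0 * (1 + (lam * (a + c) - x0))).
  by rewrite mulr_ge0 ?subr_ge0.
rewrite -subr_ge0.
have -> : (1 - q) * expR (lam * a) + q * expR (lam * (a + c)) - expR x0 =
   (1 - q) * (expR (lam * a) - expR x0 * (1 + (lam * a - x0))) +
   q * (expR (lam * (a + c)) - expR x0 * (1 + (lam * (a + c) - x0))) by rewrite /x0; ring.
exact: addr_ge0.
Qed.

(** The chord bound replaces [G] by a variable with the same mean and the two values [a] and
    [a + c]; [two_point_mgf] then applies with [p = (m - a) / c]. *)
Lemma hoeffding (G : C -> R) (a c m lam : R) : 0 <= lam -> 0 < c -> 0 <= a ->
  (forall z, a <= G z <= a + c) -> (\int[rho]_z (G z)%:E = m%:E)%E ->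
  (\int[rho]_z (expR (lam * G z))%:E <= (expR (lam * m + (lam * c) ^+ 2 / 8))%:E)%E.
Proof.
move=> lam0 c0 a0 hG hm.
pose b := (expR (lam * (a + c)) - expR (lam * a)) / c.
have b0 : 0 <= b.
  rewrite divr_ge0 ?(ltW c0)// subr_ge0 ler_expR ler_wpM2l//; lra.
have Ga z : 0 <= G z - a by rewrite subr_ge0; have /andP[] := hG z.
have hma : (\int[rho]_z (G z - a)%:E = (m - a)%:E)%E.
  have : (\int[rho]_z (G z - a)%:E + a%:E = m%:E)%E.
    rewrite -hm -[a%:E in LHS](integral_probability_cst rho) -ge0_integralD//.
    - by apply: eq_integral => z _; rewrite -EFinD subrK.
    - by move=> z _; rewrite lee_fin.
  by case: (\int[rho]_z _)%E => // x [<-]; rewrite addrK.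
have ma : 0 <= m - a by rewrite -lee_fin -hma; apply: integral_ge0 => z _; rewrite lee_fin.
have mc : m - a <= c.
  rewrite -lee_fin -hma -[leRHS](integral_probability_cst rho).
  apply: le_lower_integral => z; rewrite lee_fin//.
  by have /andP[_] := hG z; lra.
apply: (@le_trans _ _ (\int[rho]_z ((expR (lam * a))%:E + b%:E * (G z - a)%:E))%E).
  apply: le_lower_integral => z; first by rewrite lee_fin expR_ge0.
  rewrite -EFinM -EFinD lee_fin.
  have hq : 0 <= (G z - a) / c <= 1.
    rewrite divr_ge0 ?Ga ?(ltW c0)//= ler_pdivrMr// mul1r.
    by have /andP[_] := hG z; lra.
  have -> : G z = a + (G z - a) / c * c by field; rewrite gt_eqF.
  apply: le_trans (expR_chord lam a c hq) _.
  have -> : a + (G z - a) / c * c - a = G z - a by field; rewrite gt_eqF.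
  by rewrite /b le_eqVlt; apply/orP; left; apply/eqP; field; rewrite gt_eqF.
have hI : (\int[rho]_z ((expR (lam * a))%:E + b%:E * (G z - a)%:E) =
   (expR (lam * a) + b * (m - a))%:E)%E.
  rewrite ge0_integralD//; last by move=> z _; rewrite mule_ge0 ?lee_fin.
  rewrite integral_probability_cst ge0_integralZl_EFin//; last by move=> z _; rewrite lee_fin.
  by rewrite hma.
rewrite hI lee_fin.
have hp : 0 <= (m - a) / c <= 1.
  by rewrite divr_ge0 ?(ltW c0)//= ler_pdivrMr// mul1r.
have := two_point_mgf (lam * c) hp.
rewrite -(ler_pM2l (expR_gt0 (lam * a))) -expRD => h.
have -> : expR (lam * a) + b * (m - a) =
  expR (lam * a) * (1 - (m - a) / c + (m - a) / c * expR (lam * c)).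
  by rewrite /b [lam * (a + c)]mulrDr expRD; field; rewrite gt_eqF.
apply: le_trans h _; rewrite ler_expR le_eqVlt; apply/orP; left; apply/eqP.
by field; rewrite gt_eqF.
Qed.

Lemma iint_allD k (F G : seq C -> \bar R) :
  (forall s, 0 <= F s)%E -> (forall s, 0 <= G s)%E ->
  (iint rho k (fun s => F s + G s) = iint rho k F + iint rho k G)%E.
Proof.
elim: k F G => //= k IH F G F0 G0; rewrite -ge0_integralD//.
- by apply: eq_integral => z _; exact: IH.
- by move=> z _; apply: iint_ge0.
- by move=> z _; apply: iint_ge0.
Qed.

Definition bounded_differences (k : nat) (F : seq C -> R) (c : R) :=
  forall s1 s2 z z', (size s1 + size s2).+1 = k ->
    F (s1 ++ z :: s2) <= F (s1 ++ z' :: s2) + c.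

(** Induction on the first entry: the conditional mean [m z] given that entry again oscillates by at
    most [c], hence lies between its infimum [a] and [a + c], and [hoeffding] for [m] supplies one
    more factor. *)
Lemma mcdiarmid_mgf k (F : seq C -> R) (c : R) : 0 < c ->
  (forall s, 0 <= F s <= 1) -> bounded_differences k F c ->
  exists2 m : R, iint rho k (EFin \o F) = m%:E &
  0 <= m <= 1 /\ forall lam, 0 <= lam ->
   (iint rho k (fun s => (expR (lam * F s))%:E)
     <= (expR (lam * m + k%:R * ((lam * c) ^+ 2 / 8)))%:E)%E.
Proof.
move=> c0; elim: k F => [|k IH] F F01 bF.
  exists (F [::]) => //; split; first exact: F01.
  by move=> lam lam0; rewrite mul0r addr0.
have /choice[m hm] : forall z, exists m : R, iint rho k (EFin \o (fun s => F (z :: s))) = m%:E /\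
  (0 <= m <= 1 /\ forall lam, 0 <= lam ->
   (iint rho k (fun s => (expR (lam * F (z :: s)))%:E)
     <= (expR (lam * m + k%:R * ((lam * c) ^+ 2 / 8)))%:E)%E).
  move=> z; have [|s1 s2 y y' hs|m h1 h2] := IH (fun s => F (z :: s)); last by exists m.
  - by move=> s; exact: F01.
  - by rewrite -!cat_cons; apply: bF; rewrite /= addSn hs.
have m01 z : 0 <= m z <= 1 by have [_ []] := hm z.
have mdiff z z' : m z <= m z' + c.
  rewrite -lee_fin EFinD; have [<- _] := hm z; have [<- _] := hm z'.
  rewrite -[c%:E](iint_cst rho k).
  apply: (@le_trans _ _ (iint rho k (fun s => (F (z' :: s))%:E + c%:E)%E)).
    apply: le_iint => s ss /=; rewrite ?lee_fin; first by have /andP[] := F01 (z :: s).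
    by apply: (bF [::]); rewrite /= ss.
  by rewrite iint_allD// => s; rewrite lee_fin; [have /andP[] := F01 (z' :: s)|exact: ltW].
pose a := inf (range m).
have hlb : has_lbound (range m) by exists 0 => _ [z _ <-]; have /andP[] := m01 z.
have hG z : a <= m z <= a + c.
  apply/andP; split; first by apply: ge_inf => //; exists z.
  rewrite -lerBlDr; apply: lb_le_inf; first by exists (m z), z.
  by move=> _ [z' _ <-]; rewrite lerBlDr.
have a0 : 0 <= a.
  by apply: lb_le_inf; [exists (m point), point|move=> _ [z' _ <-]; have /andP[] := m01 z'].
have I1 : (\int[rho]_z (m z)%:E <= 1)%E.
  rewrite -[leRHS](integral_probability_cst rho); apply: le_lower_integral => z;
  by rewrite lee_fin; have /andP[] := m01 z.
have I0 : (0 <= \int[rho]_z (m z)%:E)%E.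
  by apply: integral_ge0 => z _; rewrite lee_fin; have /andP[] := m01 z.
have [M hM] : exists M, (\int[rho]_z (m z)%:E = M%:E)%E.
  by move: I0 I1; case: (\int[rho]_z _)%E => // M; exists M.
exists M.
  rewrite -hM /=; apply: eq_integral => z _; by have [] := hm z.
rewrite hM !lee_fin in I0 I1; split; first by rewrite I0 I1.
move=> lam lam0.
refine (le_trans (y := (\int[rho]_z ((expR (k%:R * ((lam * c) ^+ 2 / 8)))%:E * (expR (lam * m z))%:E))%E) _ _).
  rewrite /=; apply: le_lower_integral => z.
    by apply: iint_ge0 => s; rewrite lee_fin expR_ge0.
  have [_ [_ /(_ lam lam0)]] := hm z.
  by rewrite addrC expRD EFinM.
rewrite ge0_integralZl_EFin ?expR_ge0//.
have := hoeffding lam0 c0 a0 hG hM.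
move=> /(lee_wpmul2l) => /(_ (expR (k%:R * ((lam * c) ^+ 2 / 8)))%:E).
rewrite lee_fin expR_ge0 => /(_ isT) h; apply: le_trans h _.
rewrite -EFinM -expRD lee_fin ler_expR -natr1 le_eqVlt; apply/orP; left; apply/eqP.
by field.
Qed.

Lemma mcdiarmid k (F : seq C -> R) (c t : R) : 0 < c -> 0 <= t -> (0 < k)%N ->
  (forall s, 0 <= F s <= 1) -> bounded_differences k F c ->
  exists2 m : R, iint rho k (EFin \o F) = m%:E &
  ((1 - expR (- (2 * t ^+ 2 / (k%:R * c ^+ 2))))%:E <=
    iint rho k (fun s => (if F s <= m + t then 1 else 0)%:E))%E.
Proof.
move=> c0 t0 k0 F01 bF; have [m hm [_ hexp]] := mcdiarmid_mgf c0 F01 bF.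
exists m => //.
have kc : 0 < k%:R * c ^+ 2 by rewrite mulr_gt0 ?ltr0n ?exprn_gt0.
(* Minimizer of the Chernoff exponent [- lam t + k (lam c)^2 / 8], where its value is
   [- 2 t^2 / (k c^2)]. *)
pose lam := 4 * t / (k%:R * c ^+ 2).
have lam0 : 0 <= lam by rewrite divr_ge0 ?(ltW kc)// mulr_ge0.
set I := iint _ _ _.
have hE : (iint rho k (fun s => (expR (- lam * (m + t)))%:E * (expR (lam * F s))%:E)
   <= (expR (- (2 * t ^+ 2 / (k%:R * c ^+ 2))))%:E)%E.
  have iZ j (x : R) (H : seq C -> \bar R) : 0 <= x -> (forall s, 0 <= H s)%E ->
    (iint rho j (fun s => x%:E * H s) = x%:E * iint rho j H)%E.
    move=> x0; elim: j H => //= j IH H H0; rewrite -ge0_integralZl_EFin//.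
    - by apply: eq_integral => z _; exact: IH.
    - by move=> z _; apply: iint_ge0.
  rewrite iZ ?expR_ge0//.
  have e0 : (0 <= (expR (- lam * (m + t)))%:E)%E by rewrite lee_fin expR_ge0.
  refine (le_trans (lee_wpmul2l e0 (hexp lam lam0)) _).
  rewrite -EFinM -expRD lee_fin ler_expR le_eqVlt; apply/orP; left; apply/eqP.
  rewrite /lam; field.
  by rewrite (gt_eqF c0) pnatr_eq0 -lt0n k0.
(* Markov's inequality in additive form: pointwise, 1 is at most the indicator of [F s <= m + t]
   plus [expR (lam * (F s - m - t))]. *)
have : (1 <= I + (expR (- (2 * t ^+ 2 / (k%:R * c ^+ 2))))%:E)%E.
  apply: le_trans (leeD (le_refl I) hE).
  rewrite /I -iint_allD; last 2 first.
  - by move=> s; rewrite lee_fin; case: ifP.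
  - by move=> s; rewrite -EFinM lee_fin mulr_ge0 ?expR_ge0.
  rewrite -[leLHS](iint_cst rho k); apply: le_iint => s _; rewrite ?lee01//.
  rewrite -EFinM -EFinD lee_fin -expRD; case: ifP => h.
    by rewrite lerDl expR_ge0.
  rewrite add0r -[leLHS]expR0 ler_expR mulNr addrC -mulrBr mulr_ge0// subr_ge0 ltW//.
  by rewrite ltNge h.
by rewrite EFinB leeBlDr.
Qed.

End mcdiarmid.

(** * Symmetrization of the empirical process *)

Section symmetrization.
Context (R : realType) d (Z : measurableType d) (Q : probability Z R).
Local Open Scope ereal_scope.

Definition ehalf (x : \bar R) : \bar R := (1 / 2)%:E * x.

Let h0 : 0 <= (1 / 2 : R)%:E :> \bar R.
Proof. by rewrite lee_fin divr_ge0. Qed.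

Lemma ehalf_ge0 x : 0 <= x -> 0 <= ehalf x.
Proof. by move=> x0; apply: mule_ge0. Qed.

Lemma ehalfD x y : 0 <= x -> 0 <= y -> ehalf (x + y) = ehalf x + ehalf y.
Proof. by move=> x0 y0; rewrite /ehalf ge0_muleDr. Qed.

Lemma le_ehalf x y : x <= y -> ehalf x <= ehalf y.
Proof. by move=> xy; apply: lee_wpmul2l. Qed.

(** The index set is countable so that this supremum stays measurable; it will enumerate rational
    rectangles. *)
Definition nrm (x : nat -> R) : \bar R := ereal_sup (range (fun a => `|x a|%:E)).

Lemma nrm_ub x a : `|x a|%:E <= nrm x.
Proof. by apply: ereal_sup_ubound; exists a. Qed.

Lemma nrm_ge0 x : 0 <= nrm x.
Proof. by apply: le_trans (nrm_ub x 0%N); rewrite lee_fin. Qed.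

Lemma nrm_le x b : (forall a, `|x a|%:E <= b) -> nrm x <= b.
Proof. by move=> h; apply: ge_ereal_sup => _ [a _ <-]. Qed.

Lemma measurable_nrm dY (Y : measurableType dY) (x : Y -> nat -> R) :
  (forall a, measurable_fun setT (x^~ a)) -> measurable_fun setT (fun y => nrm (x y)).
Proof.
move=> mx.
have -> : (fun y => nrm (x y)) = (fun y => esups (fun a => `|x y a|%:E) 0%N).
  apply/funext => y; rewrite /nrm /esups /=; congr ereal_sup.
  by apply/seteqP; split => _ [a _ <-]; exists a.
apply: (@measurable_fun_esups _ _ _ _ (fun a y => `|x y a|%:E)) => a.
apply/measurable_EFinP; exact: measurableT_comp.
Qed.

Variable (f : nat -> Z -> R).
Hypothesis mf : forall a, measurable_fun setT (f a).
Variable m : nat -> R.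
Hypothesis f01 : forall a z, (0 <= f a z <= 1)%R.
Hypothesis fm : forall a, \int[Q]_z (f a z)%:E = (m a)%:E.

(* Average over all signs of the norm of [c + 2 * sum_l sign_l * f(z_l)]. *)
Fixpoint rade (c : nat -> R) (s : seq Z) : \bar R :=
  if s is z :: s' then ehalf (rade (fun a => c a + 2 * f a z)%R s')
                       + ehalf (rade (fun a => c a - 2 * f a z)%R s')
  else nrm c.

Lemma rade_ge0 c s : 0 <= rade c s.
Proof.
elim: s c => [|z s IH] c /=; first exact: nrm_ge0.
by apply: adde_ge0; apply: ehalf_ge0; exact: IH.
Qed.

(** Midpoint convexity of the norm passes through the sign averages because both arguments receive
    the same signed shifts. *)
Lemma rade_midpoint c c' s :
  rade (fun a => (c a + c' a) / 2)%R s <= ehalf (rade c s) + ehalf (rade c' s).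
Proof.
elim: s c c' => [|z s IH] c c' /=.
  apply: nrm_le => a; apply: (@le_trans _ _ (ehalf `|c a|%:E + ehalf `|c' a|%:E)).
    rewrite /ehalf -!EFinM -EFinD lee_fin normrM (ger0_norm (_ : 0 <= 2^-1)%R) ?invr_ge0//.
    have := ler_normD (c a) (c' a); lra.
  by apply: leeD; apply: le_ehalf; exact: nrm_ub.
have e1 : (fun a => (c a + c' a) / 2 + 2 * f a z)%R =
  (fun a => ((c a + 2 * f a z) + (c' a + 2 * f a z)) / 2)%R by apply/funext => a; field.
have e2 : (fun a => (c a + c' a) / 2 - 2 * f a z)%R =
  (fun a => ((c a - 2 * f a z) + (c' a - 2 * f a z)) / 2)%R by apply/funext => a; field.
rewrite e1 e2; apply: le_trans (leeD (le_ehalf (IH _ _)) (le_ehalf (IH _ _))) _.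
rewrite !ehalfD ?adde_ge0 ?ehalf_ge0 ?rade_ge0//.
by rewrite addeACA.
Qed.

Lemma measurable_rade dY (Y : measurableType dY) (c : Y -> nat -> R) k (zs : nat -> Y -> Z) :
  (forall a, measurable_fun setT (c^~ a)) -> (forall i, measurable_fun setT (zs i)) ->
  measurable_fun setT (fun y => rade (c y) (mkseq (zs^~ y) k)).
Proof.
elim: k c zs => [|k IH] c zs mc mzs; first exact: measurable_nrm.
under eq_fun do rewrite mkseqS /=.
have mh g : measurable_fun setT g -> measurable_fun setT (fun y : Y => ehalf (g y)).
  by move=> mg; apply: measurable_funeM.
apply: emeasurable_funD; apply: mh; apply: (IH _ (fun i => zs i.+1)) => // a.
- apply: measurable_funD; first exact: mc.
  by apply: measurable_funM; [exact: measurable_cst|exact: measurableT_comp].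
- apply: measurable_funB; first exact: mc.
  by apply: measurable_funM; [exact: measurable_cst|exact: measurableT_comp].
Qed.

Lemma mseq_rade dY (Y : measurableType dY) (c : Y -> nat -> R) k :
  (forall a, measurable_fun setT (c^~ a)) -> mseq k (fun y s => rade (c y) s).
Proof.
move=> mc dW W g zs mg mzs; apply: measurable_rade => // a.
exact: (measurableT_comp (mc a)).
Qed.

Let mshift (c : nat -> R) (k : R) a : measurable_fun setT (fun z => c a + k * f a z)%R.
Proof.
by apply: measurable_funD => //; apply: measurable_funM.
Qed.

Lemma measurable_rade_shift c (k : R) s :
  measurable_fun setT (fun z => rade (fun a => c a + k * f a z)%R s).
Proof.
case: s => [|z0 s]; first exact: measurable_nrm.
have := @measurable_rade _ Z (fun z a => c a + k * f a z)%R (size (z0 :: s))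
  (fun i _ => nth z0 (z0 :: s) i) (mshift c k) (fun i => measurable_cst _).
by under eq_fun do rewrite mkseq_nth.
Qed.

(** Jensen's inequality for the convex functional [rade] in its first argument: the expectation is
    pushed through the signs down to the norm, where it is the triangle inequality for integrals in
    each coordinate. *)
Lemma rade_jensen c s :
  rade (fun a => c a - 2 * m a)%R s <= \int[Q]_z rade (fun a => c a - 2 * f a z)%R s.
Proof.
have mneg c' s' : measurable_fun setT (fun z => rade (fun a => c' a - 2 * f a z)%R s').
  have := measurable_rade_shift c' (-2) s'.
  by under eq_fun do under eq_fun do rewrite mulNr.
elim: s c => [|z' s IH] c /=.
  apply: nrm_le => a.
  apply: (@le_trans _ _ (\int[Q]_z `|(c a - 2 * f a z)|%:E)); last first.
    by apply: le_lower_integral => z; [rewrite lee_fin|exact: (nrm_ub (fun a => c a - 2 * f a z)%R)].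
  have up z : ((c a - 2 * f a z) <= `|c a - 2 * f a z|)%R by exact: ler_norm.
  have dn z : (- (c a - 2 * f a z) <= `|c a - 2 * f a z|)%R.
    by rewrite -normrN; exact: ler_norm.
  have mabs : measurable_fun setT (fun z => `|c a - 2 * f a z|%:E).
    by apply/measurable_EFinP; apply: measurableT_comp => //; apply: measurable_funB => //; apply: measurable_funM.
  have I2 : \int[Q]_z (2 * f a z)%:E = (2 * m a)%:E.
    under eq_integral do rewrite EFinM.
    rewrite ge0_integralZl_EFin ?fm//; [by move=> z _; rewrite lee_fin; have /andP[] := f01 a z|].
    exact/measurable_EFinP.
  have m2 : measurable_fun setT (fun z => (2 * f a z)%:E).
    by apply/measurable_EFinP; apply: measurable_funM.
  have f20 z : (0 <= (2 * f a z)%:E).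
    by rewrite lee_fin mulr_ge0//; have /andP[] := f01 a z.
  set J := \int[Q]_z _.
  have J0 : 0 <= J by apply: integral_ge0 => z _; rewrite lee_fin.
  have cst0 (k : R) : \int[Q]_z k%:E = k%:E by exact: integral_probability_cst.
  (* The two one-sided bounds on [c a - 2 * m a], shifted by [|c a|] so that only nonnegative
     functions are integrated. *)
  have h1 : (c a + `|c a|)%:E <= J + (2 * m a)%:E + `|c a|%:E.
    rewrite -I2 -[`|c a|%:E]cst0 -[(c a + _)%:E]cst0 -!ge0_integralD//.
    - apply: le_lower_integral => z.
        by rewrite lee_fin; have := ler_norm (- c a); rewrite normrN; lra.
      by rewrite -!EFinD lee_fin; have := up z; lra.
    - by move=> z _; rewrite adde_ge0// lee_fin.
    - exact: emeasurable_funD.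
  have h2 : (2 * m a)%:E + (`|c a| - c a)%:E <= J + `|c a|%:E.
    rewrite -I2 -[`|c a|%:E]cst0 -[(`|c a| - c a)%:E]cst0 -!ge0_integralD//.
    - apply: le_lower_integral => z.
        by rewrite adde_ge0// lee_fin; have := ler_norm (c a); lra.
      by rewrite -!EFinD lee_fin; have := dn z; lra.
    - by move=> z _; rewrite lee_fin; have := ler_norm (c a); lra.
  move: J0 h1 h2; case: J => [J| |]; rewrite ?leey//.
  rewrite -!EFinD !lee_fin => J0 h1 h2.
  by rewrite ler_norml; lra.
have -> : (fun a => c a - 2 * m a + 2 * f a z')%R = (fun a => (c a + 2 * f a z') - 2 * m a)%R.
  by apply/funext => a; ring.
have -> : (fun a => c a - 2 * m a - 2 * f a z')%R = (fun a => (c a - 2 * f a z') - 2 * m a)%R.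
  by apply/funext => a; ring.
apply: le_trans (leeD (le_ehalf (IH _)) (le_ehalf (IH _))) _.
rewrite /ehalf -!ge0_integralZl_EFin//; try by move=> z _; exact: rade_ge0.
rewrite -ge0_integralD//; try by move=> z _; apply: ehalf_ge0; exact: rade_ge0.
- apply: le_lower_integral => z; first by apply: adde_ge0; apply: ehalf_ge0; exact: rade_ge0.
  rewrite le_eqVlt; apply/orP; left; apply/eqP; rewrite /ehalf; congr (_ * rade _ _ + _ * rade _ _);
  by apply/funext => a; ring.
- by apply: measurable_funeM.
- by apply: measurable_funeM.
Qed.

Fixpoint centered (c : nat -> R) (s : seq Z) : nat -> R :=
  if s is z :: s' then centered (fun a => c a + f a z - m a)%R s' else c.

(** One centred observation at a time is traded for a signed one, with an arbitrary offset [c]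
    carrying those already treated. The factor 2 of symmetrization is the weight of the signed terms
    inside [rade]. *)
Lemma symmetrization n c :
  iint Q n (fun s => nrm (centered c s)) <= iint Q n (rade c).
Proof.
elim: n c => //= n IH c.
(* [c + f z - m] is the midpoint of [c + 2 f z] and [c - 2 m], so no ghost sample is needed. *)
have pw z s : rade (fun a => c a + f a z - m a)%R s <=
    ehalf (rade (fun a => c a + 2 * f a z)%R s)
    + ehalf (\int[Q]_z' rade (fun a => c a - 2 * f a z')%R s).
  have -> : (fun a => c a + f a z - m a)%R =
     (fun a => ((c a + 2 * f a z) + (c a - 2 * m a)) / 2)%R by apply/funext => a; field.
  apply: le_trans (rade_midpoint _ _ _) _; apply: leeD => //; apply: le_ehalf.
  exact: rade_jensen.
have r0 c' s : 0 <= rade c' s by exact: rade_ge0.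
have i0 k c' : 0 <= iint Q k (rade c') by apply: iint_ge0.
have mp k (x : R) : mseq k (fun z s => rade (fun a => c a + x * f a z)%R s).
  by apply: mseq_rade => a; exact: mshift.
have mn k : mseq k (fun z s => rade (fun a => c a - 2 * f a z)%R s).
  by have := mp k (-2)%R; under eq_fun do under eq_fun do under eq_fun do rewrite mulNr.
have mip : measurable_fun setT (fun z => iint Q n (rade (fun a => c a + 2 * f a z)%R)).
  exact: measurable_iint.
have mim : measurable_fun setT (fun z => iint Q n (rade (fun a => c a - 2 * f a z)%R)).
  exact: measurable_iint.
apply: (@le_trans _ _ (\int[Q]_z (ehalf (iint Q n (rade (fun a => c a + 2 * f a z)%R))
    + ehalf (\int[Q]_z' iint Q n (rade (fun a => c a - 2 * f a z')%R))))).
  apply: le_lower_integral => z.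
    by apply: iint_ge0 => s; exact: nrm_ge0.
  apply: le_trans (IH _) _.
  apply: (@le_trans _ _ (iint Q n (fun s => ehalf (rade (fun a => c a + 2 * f a z)%R s)
    + ehalf (\int[Q]_z' rade (fun a => c a - 2 * f a z')%R s)))).
    by apply: le_iint => s _; [exact: r0|exact: pw].
  have m1 : mseq n (fun _ : unit => rade (fun a => c a + 2 * f a z)%R).
    exact: (mseq_rade n (fun a => @measurable_cst _ _ unit R setT (c a + 2 * f a z)%R)).
  have m2 : mseq n (fun _ : unit => fun s => \int[Q]_z' rade (fun a => c a - 2 * f a z')%R s).
    apply: (@mseq_int R _ Z Q _ unit _ Z n (fun _ s z' => rade (fun a => c a - 2 * f a z')%R s)) => //.
    apply: mseq_rade => a.
    apply: measurable_funB => //; apply: measurable_funM => //.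
    exact: (measurableT_comp (mf a) measurable_snd).
  rewrite iintD; last 4 first.
  - by move=> s; exact: ehalf_ge0.
  - by move=> s; apply: ehalf_ge0; apply: integral_ge0.
  - by move=> dW W g zs mg mzs; apply: measurable_funeM; exact: (m1 _ _ g zs mg mzs).
  - by move=> dW W g zs mg mzs; apply: measurable_funeM; exact: (m2 _ _ g zs mg mzs).
  by rewrite /ehalf !iintZ// ?iint_swap// => s; apply: integral_ge0.
set J := \int[Q]_z' iint Q n (rade (fun a => c a - 2 * f a z')%R).
(* The averaged term [J] is constant in [z], so its integration variable can be renamed [z]; the two
   halves then recombine into [rade] on [n.+1] points. *)
have eJ : \int[Q]_z ehalf J = \int[Q]_z ehalf (iint Q n (rade (fun a => c a - 2 * f a z)%R)).
  by rewrite integral_probability_cst /ehalf ge0_integralZl_EFin ?divr_ge0.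
rewrite ge0_integralD//; last 3 first.
- by move=> z _; exact: ehalf_ge0.
- exact: measurable_funeM.
- by move=> z _; apply: ehalf_ge0; apply: integral_ge0.
rewrite eJ -ge0_integralD//; last 4 first.
- by move=> z _; exact: ehalf_ge0.
- exact: measurable_funeM.
- by move=> z _; exact: ehalf_ge0.
- exact: measurable_funeM.
apply: le_lower_integral => z; first by apply: adde_ge0; exact: ehalf_ge0.
rewrite /ehalf -!iintZ//; last 2 first.
- exact: (mseq_rade n (fun a => @measurable_cst _ _ unit R setT (c a - 2 * f a z)%R)).
- exact: (mseq_rade n (fun a => @measurable_cst _ _ unit R setT (c a + 2 * f a z)%R)).
rewrite -iintD//.
- by move=> s; exact: ehalf_ge0.
- by move=> s; exact: ehalf_ge0.
- move=> dW W g zs mg mzs; apply: measurable_funeM.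
  exact: (mseq_rade n (fun a => @measurable_cst _ _ unit R setT (c a + 2 * f a z)%R) mg mzs).
- move=> dW W g zs mg mzs; apply: measurable_funeM.
  exact: (mseq_rade n (fun a => @measurable_cst _ _ unit R setT (c a - 2 * f a z)%R) mg mzs).
Qed.

(** For a fixed sample only the signs remain random, and the chaining bound on [rad_avg] becomes
    available. *)
Lemma rade_le c s (B : seq bool -> R) :
  (forall e, size e = size s -> nrm (fun a => c a + 2 * rsum e [seq f a z | z <- s])%R <= (B e)%:E) ->
  rade c s <= (rad_avg (size s) B)%:E.
Proof.
elim: s c B => [|z s IH] c B hB.
  have := hB [::] erefl; rewrite /= => h; apply: le_trans h; apply: nrm_le => a.
  apply: le_trans (nrm_ub _ a); by rewrite rsum_nil mulr0 addr0.
rewrite [rade _ _]/= [rad_avg _ _]/=.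
have h1 : rade (fun a => c a + 2 * f a z)%R s <= (rad_avg (size s) (fun e => B (true :: e)))%:E.
  apply: IH => e se; apply: le_trans (hB (true :: e) _); last by rewrite /= se.
  rewrite le_eqVlt; apply/orP; left; apply/eqP; congr nrm; apply/funext => a.
  by rewrite /= rsum_cons /sgn; ring.
have h2 : rade (fun a => c a - 2 * f a z)%R s <= (rad_avg (size s) (fun e => B (false :: e)))%:E.
  apply: IH => e se; apply: le_trans (hB (false :: e) _); last by rewrite /= se.
  rewrite le_eqVlt; apply/orP; left; apply/eqP; congr nrm; apply/funext => a.
  by rewrite /= rsum_cons /sgn; ring.
apply: le_trans (leeD (le_ehalf h1) (le_ehalf h2)) _.
by rewrite /ehalf -!EFinM -EFinD lee_fin; lra.
Qed.

Lemma centeredE c s a :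
  centered c s a = (c a + \sum_(z <- s) f a z - (size s)%:R * m a)%R.
Proof.
elim: s c => [|z s IH] c; first by rewrite /= big_nil mul0r; ring.
by rewrite [centered _ _]/= IH big_cons /= -natr1; ring.
Qed.

Lemma mseq_centered k : mseq k (fun (_ : unit) s => nrm (centered (fun=> 0%R) s)).
Proof.
move=> dW W g zs mg mzs; apply: measurable_nrm => a.
have : forall c : W -> nat -> R, (forall a, measurable_fun setT (c^~ a)) ->
    measurable_fun setT (fun y => centered (c y) (mkseq (zs^~ y) k) a).
  elim: k zs mzs => [|k IH] zs mzs c mc; first exact: mc.
  under eq_fun do rewrite mkseqS /=.
  apply: (IH (fun i => zs i.+1)) => // b.
  apply: measurable_funB => //; apply: measurable_funD => //.
  exact: measurableT_comp.
by move=> /(_ (fun _ _ => 0%R)); apply.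
Qed.

End symmetrization.

(** The bound of [rad_avg_rectangles] is uniform in the sample, so integrating it over the
    symmetrized process gives [2 * 87 * sqrt n], and division by [n] gives the rate. *)
Lemma empirical_rectangles (R : realType) d (Z : measurableType d) (Q : probability Z R)
    (phi : Z -> R * R) (q : nat -> (R * R) * (R * R)) (m : nat -> R) n :
  (forall a, measurable_fun setT (fun z => (in_rect (q a) (phi z))%:R : R)) ->
  (forall a, \int[Q]_z ((in_rect (q a) (phi z))%:R)%:E = (m a)%:E)%E -> (0 < n)%N ->
  (iint Q n (fun s => nrm (fun a => m a - (\sum_(z <- s) (in_rect (q a) (phi z))%:R) / n%:R)%R)
    <= (174 / Num.sqrt n%:R)%:E)%E.
Proof.
move=> mf fm n0.
pose f a z : R := (in_rect (q a) (phi z))%:R.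
have f01 a z : 0 <= f a z <= 1 by rewrite /f; case: in_rect; rewrite ?lexx ler01.
have nR : 0 < n%:R :> R by rewrite ltr0n.
have sn0 : 0 < Num.sqrt n%:R :> R by rewrite sqrtr_gt0.
have h1 : (iint Q n (fun s => nrm (centered f m (fun=> 0%R) s)) <= (174 * Num.sqrt n%:R)%:E)%E.
  apply: le_trans (symmetrization mf f01 fm n (fun=> 0)) _.
  rewrite -[leRHS](iint_cst Q n); apply: le_iint => s ss; first exact: rade_ge0.
  have [|B hB1 hB2] := @rad_avg_rectangles R (map phi s); first by rewrite size_map ss.
  rewrite size_map ss in hB1.
  have hB : forall e, size e = size s ->
     (nrm (fun a => 0 + 2 * rsum e [seq f a z | z <- s])%R <= (2 * B e)%:E)%E.
    move=> e _; apply: nrm_le => a; rewrite lee_fin add0r normrM ger0_norm// ler_pM2l//.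
    by have := hB2 (q a) e; rewrite -map_comp.
  apply: le_trans (rade_le hB) _.
  by rewrite ss rad_avgZ lee_fin; lra.
have e1 : forall s, size s = n -> nrm (fun a => m a - (\sum_(z <- s) f a z) / n%:R)
   = ((n%:R^-1)%:E * nrm (centered f m (fun=> 0%R) s))%E.
  move=> s ss; apply/eqP; rewrite eq_le; apply/andP; split.
    apply: nrm_le => a.
    apply: (@le_trans _ _ ((n%:R^-1)%:E * `|centered f m (fun=> 0%R) s a|%:E)%E); last first.
      by apply: lee_wpmul2l; [rewrite lee_fin invr_ge0|exact: nrm_ub].
    rewrite -EFinM lee_fin centeredE ss add0r distrC.
    rewrite -[X in X * `|_|]ger0_norm ?invr_ge0// -normrM le_eqVlt; apply/orP; left; apply/eqP.
    by congr `|_|; field; rewrite gt_eqF.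
  rewrite -(@lee_pdivlMl _ n%:R^-1) ?invr_gt0// invrK.
  apply: nrm_le => a.
  apply: (@le_trans _ _ (n%:R%:E * `|m a - (\sum_(z <- s) f a z) / n%:R|%R%:E)%E); last first.
    by apply: lee_wpmul2l; [rewrite lee_fin|exact: (nrm_ub (fun a => m a - (\sum_(z <- s) f a z) / n%:R))].
  rewrite -EFinM lee_fin centeredE ss add0r distrC.
  rewrite -[X in X * `|_|]ger0_norm// -normrM le_eqVlt; apply/orP; left; apply/eqP.
  by congr `|_|; field; rewrite gt_eqF.
rewrite (eq_iint Q e1) iintZ ?invr_ge0//; last 2 first.
- by move=> s; exact: nrm_ge0.
- exact: mseq_centered.
apply: le_trans (lee_wpmul2l _ h1) _; first by rewrite lee_fin invr_ge0.
rewrite -EFinM lee_fin le_eqVlt; apply/orP; left; apply/eqP.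
rewrite -[X in X^-1 * _](sqr_sqrtr (ltW nR)); field.
by rewrite gt_eqF.
Qed.

(** * Sequences of independent uniform variables *)

Section uniform_law.
Context (R : realType).

Lemma measurable_unit_itv : measurable (@unit_itv R).
Proof. exact: measurable_itv. Qed.

Definition lam01 : set (measurableTypeR R) -> \bar R :=
  mrestr (@lebesgue_measure R) measurable_unit_itv.

HB.instance Definition _ := Measure.on lam01.

Let lam01_setT : lam01 setT = 1%E.
Proof.
rewrite /lam01 /mrestr setTI /unit_itv lebesgue_measure_itv/= lte_fin ltr01.
by rewrite -EFinB subr0.
Qed.

HB.instance Definition _ := Measure_isProbability.Build _ _ _ lam01 lam01_setT.

Lemma lam01_set1 x : lam01 [set x] = 0%E.
Proof.
apply/eqP; rewrite eq_le measure_ge0 andbT -(lebesgue_measure_set1 x).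
apply: le_measure; rewrite ?inE.
- by apply: measurableI => //; exact: measurable_unit_itv.
- exact: measurable_set1.
- exact: subIsetl.
Qed.

Lemma lam01_fin A : measurable A -> lam01 A \is a fin_num.
Proof. exact: (fin_num_measure (lam01 : probability _ R)). Qed.

End uniform_law.

Section sequence_space.
Context (R : realType).
Local Notation Rm := (measurableTypeR R).

(** A generating family stable under intersection: two laws on sequences that agree on these sets
    coincide, so a single sequence space carries every functional of the whole family [T]. *)
Definition cylinders : set (set (nat -> Rm)) :=
  [set A | exists k (B : nat -> set Rm), (forall i, measurable (B i)) /\
     A = [set t | forall i, (i < k)%N -> B i (t i)]].

Definition seqR := g_sigma_algebraType cylinders.

Lemma measurable_seqP d (Om : measurableType d) (X : Om -> seqR) :
  (forall i, measurable_fun setT (fun w => X w i)) -> measurable_fun setT X.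
Proof.
move=> mX; refine (@measurability _ _ Om seqR setT X cylinders erefl _) => _ [_ [k [B [mB ->]]] <-].
rewrite setTI.
have -> : X @^-1` [set t | forall i, (i < k)%N -> B i (t i)] =
    \bigcap_(i in [set i | (i < k)%N]) ((fun w => X w i) @^-1` (B i)).
  by apply/seteqP; split.
apply: bigcap_measurableType => i _.
by rewrite -[X in measurable X]setTI; exact: mX.
Qed.

Lemma measurable_coord i : measurable_fun setT (fun t : seqR => t i : Rm).
Proof.
move=> _ A mA; rewrite setTI; apply: sub_sigma_algebra.
exists i.+1, (fun j => if j == i then A else setT); split.
  by move=> j; case: ifP.
apply/seteqP; split => t /=.
  by move=> At j _; case: eqP => // ->.
by move=> /(_ i (ltnSn i)); rewrite eqxx.
Qed.

Lemma cylinders_setI : setI_closed cylinders.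
Proof.
move=> _ _ [k [B [mB ->]]] [k' [B' [mB' ->]]].
exists (maxn k k'), (fun i => (if (i < k)%N then B i else setT) `&` (if (i < k')%N then B' i else setT)).
split.
  by move=> i; apply: measurableI; case: ifP.
apply/seteqP; split => t /=.
  by move=> [h h'] i _; split; case: ifP => // ik; [exact: h|exact: h'].
move=> h; split => i ik.
  by have [] := h i (leq_trans ik (leq_maxl _ _)); rewrite ik.
by have [] := h i (leq_trans ik (leq_maxr _ _)); rewrite ik.
Qed.

Definition uniform_seq d (Om : measurableType d) (P : probability Om R)
    (X : nat -> Om -> Rm) : Prop :=
  (forall i, measurable_fun setT (X i)) /\
  forall k (B : nat -> set Rm), (forall i, measurable (B i)) ->
    P [set w | forall i, (i < k)%N -> B i (X i w)] = (\prod_(i < k) fine (lam01 (B i)))%:E.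

(** The source of every coupling below: any injective choice of entries of [T] is again an
    independent uniform sequence. *)
Lemma iid_uniform_seq d (Om : measurableType d) (P : probability Om R)
    (T : nat -> Om -> Rm) (s : nat -> nat) : iid_uniform01 P T -> injective s ->
  uniform_seq P (fun i => T (s i)).
Proof.
move=> [mT hT] inj_s; split => [i|k B mB]; first exact: mT.
rewrite -[RHS](hT k (fun i => s i) _ (fun i => B i))//; last by move=> i j /inj_s /val_inj.
congr (P _); apply/seteqP; split => w /= h i; first exact: h.
by move=> ik; exact: (h (Ordinal ik)).
Qed.

Definition seq_fun d (Om : measurableType d) (X : nat -> Om -> Rm) (w : Om) : seqR := fun i => X i w.

Lemma measurable_seq_fun d (Om : measurableType d) (X : nat -> Om -> Rm) :
  (forall i, measurable_fun setT (X i)) -> measurable_fun setT (seq_fun X).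
Proof. by move=> mX; exact: measurable_seqP. Qed.

Section transfer.
Context d1 (Om1 : measurableType d1) (P1 : probability Om1 R) (X : nat -> Om1 -> Rm).
Context d2 (Om2 : measurableType d2) (P2 : probability Om2 R) (Y : nat -> Om2 -> Rm).
Hypotheses (uX : uniform_seq P1 X) (uY : uniform_seq P2 Y).

Lemma uniform_seq_law (A : set seqR) : measurable A ->
  P1 (seq_fun X @^-1` A) = P2 (seq_fun Y @^-1` A).
Proof.
move=> mA.
have mX := measurable_seq_fun uX.1; have mY := measurable_seq_fun uY.1.
pose m1 : {measure set seqR -> \bar R} :=
  measure_function_pushforward__canonical__measure_function_Measure P1 mX.
pose m2 : {measure set seqR -> \bar R} :=
  measure_function_pushforward__canonical__measure_function_Measure P2 mY.
apply: (@measure_unique _ R seqR cylinders (fun=> setT) _ _ _ _ m1 m2) => //.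
- exact: cylinders_setI.
- move=> _; exists 0%N, (fun=> setT); split => //.
  by apply/seteqP; split.
- by rewrite bigcup_const//; exists 0%N.
- move=> _ [k [B [mB ->]]].
  by rewrite /m1 /m2 /= /pushforward; rewrite [LHS](uX.2 k B mB) [RHS](uY.2 k B mB).
- move=> _; rewrite /m1 /= /pushforward preimage_setT.
  by rewrite [ltLHS](probability_setT P1) ltry.
Qed.

Lemma uniform_seq_integral (F : seqR -> \bar R) : (forall t, 0 <= F t)%E ->
  measurable_fun setT F ->
  (\int[P1]_w F (seq_fun X w) = \int[P2]_w F (seq_fun Y w))%E.
Proof.
move=> F0 mF.
have mX := measurable_seq_fun uX.1; have mY := measurable_seq_fun uY.1.
have e d (Om : measurableType d) (P : probability Om R) (Z : Om -> seqR) (mZ : measurable_fun setT Z) :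
  (\int[P]_w F (Z w) = \int[pushforward P Z]_t F t)%E.
  by rewrite (ge0_integral_pushforward mZ P measurableT mF)// => t _; exact: F0.
rewrite !e//.
apply: eq_set_function_integral => A mA; exact: uniform_seq_law.
Qed.

End transfer.

Definition scons (u : Rm) (t : seqR) : seqR := fun i => if i is j.+1 then t j else u.

Section star.
Context d (Om : measurableType d) (P : probability Om R) (X : nat -> Om -> Rm).
Hypothesis uX : uniform_seq P X.

Lemma measurable_scons d' (Y : measurableType d') (u : Y -> Rm) (t : Y -> seqR) :
  measurable_fun setT u -> measurable_fun setT t -> measurable_fun setT (fun y => scons (u y) (t y)).
Proof.
move=> mu mt; apply: measurable_seqP => -[|i] //=.
exact: (measurableT_comp (measurable_coord i) mt).
Qed.

Lemma uniform_seq_scons :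
  uniform_seq ((@lam01 R : probability Rm R) \x P)%E
    (fun i (p : Rm * Om) => scons p.1 (seq_fun X p.2) i).
Proof.
split.
  move=> [|i] /=; first exact: measurable_fst.
  exact: measurableT_comp (uX.1 i) measurable_snd.
move=> [|k] B mB.
  rewrite big_ord0; have -> : [set w : Rm * Om | forall i, (i < 0)%N -> B i (scons w.1 (seq_fun X w.2) i)] = setT.
    by apply/seteqP; split.
  exact: probability_setT.
have -> : [set w : Rm * Om | forall i, (i < k.+1)%N -> B i (scons w.1 (seq_fun X w.2) i)] =
    B 0%N `*` [set w | forall i, (i < k)%N -> B i.+1 (X i w)].
  apply/seteqP; split => -[u w] /=.
    by move=> h; split; [exact: (h 0%N)|move=> i ik; exact: (h i.+1)].
  by move=> [h1 h2] [|i] //= ik; exact: h2.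
set D := [set w | _].
have mD : measurable D.
  have -> : D = \bigcap_(i in [set i | (i < k)%N]) (X i @^-1` (B i.+1)) by apply/seteqP; split.
  by apply: bigcap_measurableType => i _; rewrite -[X in measurable X]setTI; exact: (uX.1 i).
apply: etrans (product_measure1E (@lam01 R) P (mB 0%N) mD) _.
rewrite big_ord_recl EFinM fineK ?lam01_fin//; congr (_ * _)%E.
exact: (uX.2 k (fun i => B i.+1)).
Qed.

(** Prepending an independent uniform entry does not change the law of the sequence, so the first
    entry can be integrated separately. *)
Lemma uniform_seq_unfold (F : seqR -> \bar R) : (forall t, 0 <= F t)%E ->
  measurable_fun setT F ->
  (\int[P]_w F (seq_fun X w) = \int[lam01 (R:=R)]_u \int[P]_w F (scons u (seq_fun X w)))%E.
Proof.
move=> F0 mF; rewrite (uniform_seq_integral uX uniform_seq_scons F0 mF).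
have mG : measurable_fun setT (fun p : Rm * Om => F (scons p.1 (seq_fun X p.2))).
  apply: (measurableT_comp mF); apply: measurable_scons; first exact: measurable_fst.
  by apply: measurableT_comp (measurable_seq_fun uX.1) measurable_snd.
have := @fubini_tonelli1 _ _ Rm Om R (@lam01 R) P _ mG (fun p => F0 _).
by [].
Qed.

End star.
End sequence_space.

(** * Edge types and edge laws *)

Lemma mnormalize1E (R : realType) d (T : measurableType d) (mu : {measure set T -> \bar R})
    (P : probability T R) A : mu setT = 1%E -> mnormalize mu P A = mu A.
Proof. by move=> mu1; rewrite /mnormalize mu1 onee_eq0/= invr1 mule1. Qed.

Section etype_law.
Context (R : realType).
Local Open Scope ereal_scope.
Local Notation C := (bool * (nat * nat))%type.

Lemma measurable_etype (A : set C) : measurable A.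
Proof.
have -> : A = \bigcup_(n in [set n | if unpickle n is Some c then A c else False])
    (if unpickle n is Some c then [set c] else set0).
  apply/seteqP; split => [c Ac|c [n /=]].
    by exists (pickle c); rewrite /= pickleK.
  by case: (unpickle n) => // c' Ac' /= ->.
apply: bigcup_measurable => n _; case: (unpickle n : option C) => [[b [i j]]|//].
have -> : [set (b, (i, j))] = [set b] `*` ([set i] `*` [set j]).
  by apply/seteqP; split=> -[b' [i' j']] /=; [move=> [-> -> ->]|move=> [-> [-> ->]]].
by apply: measurableX => //; exact: measurableX.
Qed.

(* In a type [(b, (i, j))], index [0] stands for a fresh endpoint and [i.+1] for
   the atom [T_i]; [b = true] marks edges of the diagonal component. *)
Definition tEE i j : C := (false, (i.+1, j.+1)).
Definition tEf i : C := (false, (i.+1, 0%N)).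
Definition tfE j : C := (false, (0%N, j.+1)).
Definition tff : C := (false, (0%N, 0%N)).
Definition tD : C := (true, (0%N, 0%N)).

(** Stated through integrals of arbitrary nonnegative functions, in the shape of [grapheur_measure],
    so that the two can be compared summand by summand. *)
Definition etype_law (E : nat -> nat -> R) (sg vs : nat -> R) (th vth : R)
    (rho : probability C R) : Prop :=
  forall f : C -> \bar R, (forall c, 0 <= f c) ->
   \int[rho]_c f c =
     \sum_(i <oo) \sum_(j <oo) (E i j)%:E * f (tEE i j)
     + \sum_(i <oo) (sg i)%:E * f (tEf i) + \sum_(i <oo) (vs i)%:E * f (tfE i)
     + th%:E * f tff + vth%:E * f tD.

Lemma etype_law_exists (E : nat -> nat -> R) (sg vs : nat -> R) (th vth : R) :
  grapheur_coeffs E sg vs th vth ->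
  exists rho : probability C R, etype_law E sg vs th vth rho.
Proof.
move=> [E0 [sg0 [vs0 [th0 [vth0 sum1]]]]].
pose pt (r : R) (r0 : (0 <= r)%R) (c : C) : {measure set C -> \bar R} := mscale (NngNum r0) (dirac c).
pose mE : {measure set C -> \bar R} :=
  mseries (fun i => (mseries (fun j => pt _ (E0 i j) (tEE i j)) 0 : {measure set C -> \bar R})) 0.
pose ms : {measure set C -> \bar R} := mseries (fun i => pt _ (sg0 i) (tEf i)) 0.
pose mv : {measure set C -> \bar R} := mseries (fun i => pt _ (vs0 i) (tfE i)) 0.
pose mu : {measure set C -> \bar R} :=
  measure_add (measure_add (measure_add (measure_add mE ms) mv) (pt _ th0 tff)) (pt _ vth0 tD).
have mall (f : C -> \bar R) : measurable_fun setT f.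
  by move=> _ Y _; exact: measurable_etype.
have Ipt r r0 c (f : C -> \bar R) : (forall c, 0 <= f c) -> \int[pt r r0 c]_x f x = r%:E * f c.
  move=> f0; rewrite ge0_integral_mscale// integral_dirac// diracE.
  by rewrite mem_set// mul1e.
have Imu (f : C -> \bar R) : (forall c, 0 <= f c) -> \int[mu]_c f c =
     \sum_(i <oo) \sum_(j <oo) (E i j)%:E * f (tEE i j)
     + \sum_(i <oo) (sg i)%:E * f (tEf i) + \sum_(i <oo) (vs i)%:E * f (tfE i)
     + th%:E * f tff + vth%:E * f tD.
  move=> f0; rewrite !ge0_integral_measure_add// !Ipt//.
  rewrite !ge0_integral_measure_series//.
  congr (_ + _ + _ + _ + _); apply: eq_eseriesr => i _; rewrite ?Ipt//.
  rewrite ge0_integral_measure_series//.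
  by apply: eq_eseriesr => j _; rewrite Ipt.
have mu1 : mu setT = 1.
  rewrite -[LHS]mul1e -(integral_cst mu measurableT 1) Imu//.
  rewrite -[RHS]sum1 !mule1.
  congr (_ + _ + _ + _ + _); apply: eq_eseriesr => i _; rewrite ?mule1//.
  by apply: eq_eseriesr => j _; rewrite mule1.
(* The total mass is already 1; normalization only packages [mu] as a probability. *)
exists (mnormalize mu (dirac tff)) => f f0; rewrite -Imu//.
by apply: eq_set_function_integral => A _; exact: mnormalize1E.
Qed.

End etype_law.

Lemma measurable_fun_countable dY (Y : measurableType dY) (K : countType) (h : Y -> K)
    dW (W : measurableType dW) (F : K -> Y -> W) :
  (forall k, measurable [set y | h y = k]) -> (forall k, measurable_fun setT (F k)) ->
  measurable_fun setT (fun y => F (h y) y).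
Proof.
move=> mh mF _ B mB; rewrite setTI.
have -> : (fun y => F (h y) y) @^-1` B = \bigcup_(n in setT)
   (if unpickle n is Some k then [set y | h y = k] `&` (F k @^-1` B) else set0).
  apply/seteqP; split => [y By|y [n _]].
    by exists (pickle (h y)); rewrite //= pickleK.
  by case: (unpickle n) => // k [/= -> ].
apply: bigcup_measurable => n _; case: (unpickle n) => // k.
by apply: measurableI; [exact: mh|rewrite -[X in measurable X]setTI; exact: mF].
Qed.

(** * Edges of the grapheur as decoded types *)

Section edge_law.
Context (R : realType).
Local Notation Rm := (measurableTypeR R).
Local Notation C := (bool * (nat * nat))%type.
Local Open Scope ereal_scope.

Definition vtx (t : nat -> Rm) (i : nat) (u : Rm) : Rm := if i is j.+1 then t j else u.

Definition edge (t : nat -> Rm) (q : C * (Rm * Rm)) : Rm * Rm :=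
  if q.1.1 then (q.2.1, q.2.1) else (vtx t q.1.2.1 q.2.1, vtx t q.1.2.2 q.2.2).

Definition lam2 : probability (Rm * Rm)%type R := (@lam01 R \x @lam01 R)%E.

Lemma measurable_edge_type dY (Y : measurableType dY) (t : Y -> seqR R) (c : C) (u : Y -> Rm * Rm) :
  measurable_fun setT t -> measurable_fun setT u ->
  measurable_fun setT (fun y => edge (t y) (c, u y)).
Proof.
move=> mt mu.
have mv i (f : Y -> Rm) : measurable_fun setT f -> measurable_fun setT (fun y => vtx (t y) i (f y)).
  move=> mf; case: i => [|i] //=.
  exact: (measurableT_comp (measurable_coord i) mt).
have m1 : measurable_fun setT (fun y => (u y).1) by exact: measurableT_comp measurable_fst mu.
have m2 : measurable_fun setT (fun y => (u y).2) by exact: measurableT_comp measurable_snd mu.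
rewrite /edge /=; case: c.1; first exact: measurable_fun_pair.
by apply: measurable_fun_pair; exact: mv.
Qed.

Lemma measurable_edge dY (Y : measurableType dY) (t : Y -> seqR R) (q : Y -> C * (Rm * Rm)) :
  measurable_fun setT t -> measurable_fun setT q ->
  measurable_fun setT (fun y => edge (t y) (q y)).
Proof.
move=> mt mq.
have -> : (fun y => edge (t y) (q y)) = (fun y => edge (t y) ((q y).1, (q y).2)).
  by apply/funext => y; case: (q y).
have m1 : measurable_fun setT (fun y => (q y).1) by exact: measurableT_comp measurable_fst mq.
have m2 : measurable_fun setT (fun y => (q y).2) by exact: measurableT_comp measurable_snd mq.
apply: (@measurable_fun_countable _ _ C (fun y => (q y).1) _ _ (fun c y => edge (t y) (c, (q y).2))).
- move=> c; have := m1 measurableT [set c] (measurable_etype _); rewrite setTI; exact.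
- by move=> c; exact: measurable_edge_type.
Qed.

Lemma measurable_edge2 (t : seqR R) : measurable_fun setT (edge t).
Proof.
exact: (@measurable_edge _ _ (cst t) idfun (@measurable_cst _ _ _ _ setT t) (@measurable_id _ _ setT)).
Qed.

Lemma lam2_fst (A : set Rm) : measurable A -> lam2 [set u | A u.1] = lam01 A.
Proof.
move=> mA; have -> : [set u : Rm * Rm | A u.1] = A `*` setT.
  by apply/seteqP; split=> -[x y] //= [].
rewrite /lam2; apply: etrans (product_measure1E (@lam01 R) (@lam01 R) mA measurableT) _.
by rewrite [X in _ * X](probability_setT (lam01 (R:=R) : probability _ R)) mule1.
Qed.

Lemma lam2_snd (A : set Rm) : measurable A -> lam2 [set u | A u.2] = lam01 A.
Proof.
move=> mA; have -> : [set u : Rm * Rm | A u.2] = setT `*` A.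
  by apply/seteqP; split=> -[x y] //= [].
rewrite /lam2; apply: etrans (product_measure1E (@lam01 R) (@lam01 R) measurableT mA) _.
by rewrite [X in X * _](probability_setT (lam01 (R:=R) : probability _ R)) mul1e.
Qed.

Lemma lam2_restr (A : set (Rm * Rm)) : measurable A ->
  lam2 A = (@lebesgue_measure R \x @lebesgue_measure R) (A `&` (unit_itv `*` unit_itv)).
Proof.
move=> mA.
have mUU : measurable (@unit_itv R `*` @unit_itv R) by apply: measurableX; exact: measurable_unit_itv.
pose m' : {measure set (Rm * Rm) -> \bar R} := mrestr (@lebesgue_measure R \x @lebesgue_measure R) mUU.
suff H (B1 B2 : set Rm) : measurable B1 -> measurable B2 -> m' (B1 `*` B2) = lam01 B1 * lam01 B2.
  exact: (@product_measure_unique _ _ Rm Rm R (@lam01 R) (@lam01 R) m' H A mA).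
move=> mB1 mB2; rewrite /m' /= /mrestr.
have -> : (B1 `*` B2) `&` (unit_itv `*` unit_itv) = (B1 `&` unit_itv) `*` (B2 `&` unit_itv).
  by apply/seteqP; split => -[x y] /=; tauto.
by apply: product_measure1E; apply: measurableI => //; exact: measurable_unit_itv.
Qed.

Section with_coeffs.
Variables (E : nat -> nat -> R) (sg vs : nat -> R) (th vth : R) (rho : probability C R).
Hypothesis rhoE : etype_law E sg vs th vth rho.

Definition edge_code_law : probability (C * (Rm * Rm))%type R := (rho \x lam2)%E.

(** For fixed vertices [t] the grapheur is the image under [edge t] of a law of codes that does not
    depend on [t]; each kind of type produces the corresponding summand of [grapheur_measure]. *)
Lemma edge_lawE (t : seqR R) (A : set (Rm * Rm)) : measurable A ->
  grapheur_measure E sg vs th vth t A = edge_code_law (edge t @^-1` A).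
Proof.
move=> mA.
have -> : edge_code_law (edge t @^-1` A) = \int[rho]_c lam2 [set u | A (edge t (c, u))].
  rewrite /edge_code_law; apply: eq_integral => c _ /=; congr (lam2 _).
  by apply/seteqP; split => u; rewrite /xsection /= inE.
rewrite rhoE//.
have mx1 i : measurable [set y | A (t i, y)].
  have := measurable_xsection (t i) mA; congr (measurable _).
  by apply/seteqP; split => y; rewrite /xsection /= inE.
have mx2 i : measurable [set x | A (x, t i)].
  have := measurable_ysection (t i) mA; congr (measurable _).
  by apply/seteqP; split => y; rewrite /ysection /= inE.
rewrite /grapheur_measure /edge /=; congr (_ + _ + _ + _ + _).
- apply: eq_eseriesr => i _; apply: eq_eseriesr => j _; congr (_ * _).
  rewrite indicE; case: (pselect (A (t i, t j))) => h.
    rewrite mem_set//=; have -> : [set u : Rm * Rm | A (t i, t j)] = setT by apply/seteqP; split.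
    by rewrite [RHS]probability_setT.
  rewrite memNset//=; have -> : [set u : Rm * Rm | A (t i, t j)] = set0 by apply/seteqP; split.
  by rewrite [RHS]measure0.
- apply: eq_eseriesr => i _; congr (_ * _).
  rewrite (lam2_snd (mx1 i)) /lam01 /mrestr; congr (lebesgue_measure _).
  by apply/seteqP; split => y /=; tauto.
- apply: eq_eseriesr => i _; congr (_ * _).
  rewrite (lam2_fst (mx2 i)) /lam01 /mrestr; congr (lebesgue_measure _).
  by apply/seteqP; split => y /=; tauto.
- by rewrite -lam2_restr.
- congr (_ * _).
  have mD : measurable [set x | A (x, x)].
    rewrite -[X in measurable X]setTI.
    by apply: (measurable_fun_pair (@measurable_id _ Rm setT) (@measurable_id _ Rm setT)).
  rewrite (lam2_fst mD) /lam01 /mrestr; congr (lebesgue_measure _).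
  by apply/seteqP; split => y /=; tauto.
Qed.

Definition edge_law (t : seqR R) : {measure set (Rm * Rm) -> \bar R} :=
  measure_function_pushforward__canonical__measure_function_Measure edge_code_law (measurable_edge2 t).

Lemma grapheur_edge_law t A : measurable A ->
  grapheur_measure E sg vs th vth t A = edge_law t A.
Proof. exact: edge_lawE. Qed.

Lemma integral_edge_law t (f : Rm * Rm -> \bar R) : measurable_fun setT f -> (forall z, 0 <= f z) ->
  \int[edge_law t]_z f z = \int[edge_code_law]_q f (edge t q).
Proof.
move=> mf f0; rewrite (ge0_integral_pushforward (measurable_edge2 t) edge_code_law measurableT mf)//.
Qed.

Lemma integral_edge_code (f : C * (Rm * Rm) -> \bar R) : measurable_fun setT f -> (forall z, 0 <= f z) ->
  \int[edge_code_law]_q f q = \int[rho]_c \int[lam2]_u f (c, u).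
Proof. by move=> mf f0; exact: (@fubini_tonelli1 _ _ _ _ R rho lam2 f mf f0). Qed.

Lemma edge_law_setT t : edge_law t setT = 1.
Proof. exact: (probability_setT edge_code_law). Qed.

Lemma measurable_edge_law A : measurable A ->
  measurable_fun setT (fun t : seqR R => edge_law t A).
Proof.
move=> mA.
pose B := (fun p : seqR R * (C * (Rm * Rm)) => edge p.1 p.2) @^-1` A.
have mB : measurable B.
  rewrite /B -[X in measurable X]setTI.
  by apply: (measurable_edge measurable_fst measurable_snd).
have := measurable_fun_xsection edge_code_law mB.
by apply: eq_measurable_fun => t _; congr (edge_code_law _); apply/seteqP; split => q; rewrite /xsection /= inE.
Qed.

End with_coeffs.
End edge_law.

Section random_measures.
Context (R : realType).
Local Notation Rm := (measurableTypeR R).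
Local Notation edges := (measurableTypeR R * measurableTypeR R)%type.
Local Open Scope ereal_scope.

(** [m] is a set function as the definitions give it, [mu] a genuine measure agreeing with it on
    measurable sets. The section serves both the grapheur and the sampled graph. *)
Variable (m : (nat -> Rm) -> set edges -> \bar R).
Variable (mu : seqR R -> {measure set edges -> \bar R}).
Hypothesis m_mu : forall t A, measurable A -> m t A = mu t A.
Hypothesis mm : forall A, measurable A -> measurable_fun setT (fun t : seqR R => m t A).

Lemma seq_random_measure d (Om : measurableType d) (X : nat -> Om -> Rm) :
  (forall i, measurable_fun setT (X i)) ->
  is_random_measure (fun w => m (seq_fun X w)).
Proof.
move=> mX; split => [w|A mA]; last first.
  exact: (measurableT_comp (mm mA) (measurable_seq_fun mX)).
split; first by rewrite m_mu// measure0.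
split => [A mA|F mF tF mUF]; first by rewrite m_mu// measure_ge0.
have := @measure_semi_sigma_additive _ _ _ (mu (seq_fun X w)) F mF tF mUF.
rewrite -m_mu//.
by under eq_fun do (under eq_bigr do rewrite -m_mu//).
Qed.

Lemma seq_same_law d1 (Om1 : measurableType d1) (P1 : probability Om1 R) (X : nat -> Om1 -> Rm)
    d2 (Om2 : measurableType d2) (P2 : probability Om2 R) (Y : nat -> Om2 -> Rm) :
  uniform_seq P1 X -> uniform_seq P2 Y ->
  same_law P1 (fun w => m (seq_fun X w)) P2 (fun w => m (seq_fun Y w)).
Proof.
move=> uX uY k A B mA mB.
apply: (@uniform_seq_law _ _ _ _ X _ _ _ Y uX uY [set t | forall i, B i (m t (A i))]).
have -> : [set t : seqR R | forall i, B i (m t (A i))] =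
   \bigcap_(i in [set: 'I_k]) ((fun t : seqR R => m t (A i)) @^-1` (B i)).
  by apply/seteqP; split => t /=; [move=> h i _; exact: h|move=> h i; exact: (h i Logic.I)].
apply: fin_bigcap_measurable => [|i _]; first exact: finite_finset.
by rewrite -[X in measurable X]setTI; exact: mm.
Qed.

End random_measures.

(** * The sampled graph as an empirical measure *)

Section sample_graph.
Context (R : realType).
Local Notation Rm := (measurableTypeR R).
Local Notation edges := (measurableTypeR R * measurableTypeR R)%type.
Implicit Types (pts : seq edges) (t : nat -> Rm).

Lemma sample_vertices_fst pts p : p \in pts -> p.1 \in sample_vertices pts.
Proof.
move=> hp; rewrite mem_undup; apply/flattenP; exists [:: p.1; p.2]; last by rewrite inE eqxx.
by apply/mapP; exists p.
Qed.

Lemma sample_vertices_snd pts p : p \in pts -> p.2 \in sample_vertices pts.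
Proof.
move=> hp; rewrite mem_undup; apply/flattenP; exists [:: p.1; p.2]; last by rewrite !inE eqxx orbT.
by apply/mapP; exists p.
Qed.

Definition vertex_index pts (x : Rm) := index x (sample_vertices pts).

(** The vertices are listed without repetition, so each sampled edge is counted by exactly one
    matrix entry: the graph measure is the empirical measure of the relabelled sample. *)
Lemma graph_measureE pts t A :
  graph_measure (sample_graph pts) t A =
  ((\sum_(p <- pts) \1_A (t (vertex_index pts p.1), t (vertex_index pts p.2))) / (size pts)%:R)%:E.
Proof.
rewrite /graph_measure; set V := sample_vertices pts; set N := size V.
have uV : uniq V by exact: undup_uniq.
under eq_bigr do under eq_bigr do rewrite -EFinM.
under eq_bigr do rewrite sumEFin.
rewrite sumEFin; congr EFin.
transitivity (\sum_(i < N) \sum_(j < N) \sum_(p <- pts)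
   (p == (nth 0 V i, nth 0 V j))%:R * \1_A (t i, t j) / (size pts)%:R : R).
  apply: eq_bigr => i _; apply: eq_bigr => j _.
  rewrite /sample_graph mxE -!big_distrl/= mulrAC; congr (_ * _ / _).
  rewrite -sum1_count natr_sum [LHS]big_mkcond; apply: eq_bigr => p _; rewrite /pred1 /=; by case: eqP.
under eq_bigr do rewrite exchange_big.
rewrite exchange_big big_distrl; apply: eq_big_seq => p hp /=.
have h1 : (vertex_index pts p.1 < N)%N by rewrite index_mem sample_vertices_fst.
have h2 : (vertex_index pts p.2 < N)%N by rewrite index_mem sample_vertices_snd.
rewrite (bigD1 (Ordinal h1))//= (bigD1 (Ordinal h2))//=.
rewrite /vertex_index -/V !nth_index ?sample_vertices_fst ?sample_vertices_snd//.
rewrite -surjective_pairing eqxx mul1r big1 ?addr0; last first.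
  move=> j jn; case: eqP; rewrite ?mul0r// => e; exfalso; move/eqP: jn; apply.
  by apply: val_inj; rewrite /= /vertex_index e /= index_uniq.
rewrite big1 ?addr0// => i ine; apply: big1 => j _.
case: eqP; rewrite ?mul0r// => e; exfalso; move/eqP: ine; apply.
by apply: val_inj; rewrite /= /vertex_index e /= index_uniq.
Qed.

Definition graph_points pts t : {measure set edges -> \bar R} :=
  mscale ((size pts)%:R^-1 : R)%:nng
   (msum (fun l => dirac (let p := nth (0, 0) pts l in
      (t (vertex_index pts p.1), t (vertex_index pts p.2)) : edges)) (size pts)).

Lemma graph_pointsE pts t A :
  graph_measure (sample_graph pts) t A = graph_points pts t A.
Proof.
rewrite graph_measureE /graph_points /= /mscale /= /msum.
rewrite mulrC EFinM -sumEFin; congr (_ * _)%E.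
by rewrite (big_nth (0, 0)) big_mkord; apply: eq_bigr.
Qed.

Lemma measurable_graph_measure pts A : measurable A ->
  measurable_fun setT (fun t : seqR R => graph_measure (sample_graph pts) t A).
Proof.
move=> mA.
have -> : (fun t : seqR R => graph_measure (sample_graph pts) t A) = (fun t : seqR R =>
    ((\sum_(p <- pts) \1_A (t (vertex_index pts p.1), t (vertex_index pts p.2))) / (size pts)%:R)%:E).
  by apply/funext => t; rewrite graph_measureE.
apply/measurable_EFinP; apply: measurable_funM => //.
apply: measurable_sum => p.
have := measurable_fun_pair (@measurable_coord R (vertex_index pts p.1))
  (@measurable_coord R (vertex_index pts p.2)).
by move=> h; apply: measurableT_comp (measurable_indic mA) h.
Qed.

End sample_graph.

(** * Redrawing the fresh endpoints *)

Section resampling.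
Context (R : realType).
Local Notation Rm := (measurableTypeR R).
Local Notation C := (bool * (nat * nat))%type.
Local Notation Z := (C * (Rm * Rm))%type.
Local Open Scope ereal_scope.

Definition sshift (k : nat) (t : seqR R) : seqR R := fun i => t (k + i)%N.

Lemma measurable_sshift k d (Y : measurableType d) (t : Y -> seqR R) :
  measurable_fun setT t -> measurable_fun setT (fun y => sshift k (t y)).
Proof.
move=> mt; apply: measurable_seqP => i.
exact: (measurableT_comp (measurable_coord (k + i)) mt).
Qed.

(* The [l]-th code draws its fresh endpoints from the entries [2 l] and [2 l + 1] of [t]. *)
Fixpoint codes (cs : seq C) (t : seqR R) : seq Z :=
  if cs is c :: cs' then (c, (t 0%N : Rm, t 1%N : Rm)) :: codes cs' (sshift 2 t) else [::].

Lemma size_codes cs t : size (codes cs t) = size cs.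
Proof. by elim: cs t => //= c cs IH t; rewrite IH. Qed.

Lemma codesE cs t : codes cs t = mkseq (fun l => (nth (false, (0, 0)%N) cs l, (t (2 * l)%N : Rm, t (2 * l).+1 : Rm))) (size cs).
Proof.
elim: cs t => //= c cs IH t; rewrite mkseqS /=; congr (_ :: _); rewrite IH.
apply: eq_mkseq => l; rewrite /= /sshift; congr (_, (t _, t _)); lia.
Qed.

Lemma mseq_codes dX (X : measurableType dX) (F : X -> seq Z -> \bar R) cs
    dY (Y : measurableType dY) (g : Y -> X) (t : Y -> seqR R) :
  mseq (size cs) F -> measurable_fun setT g -> measurable_fun setT t ->
  measurable_fun setT (fun y => F (g y) (codes cs (t y))).
Proof.
move=> mF mg mt.
have -> : (fun y => F (g y) (codes cs (t y))) = (fun y => F (g y) (mkseq ((fun l y =>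
   (nth (false, (0, 0)%N) cs l, (t y (2 * l)%N : Rm, t y (2 * l).+1 : Rm)))^~ y) (size cs))).
  by apply/funext => y; rewrite codesE.
apply: mF => // l.
have h i : measurable_fun setT (fun y => t y i : Rm) by exact: (measurableT_comp (measurable_coord i) mt).
by apply: measurable_fun_pair; [exact: measurable_cst|exact: measurable_fun_pair].
Qed.

Context d (Om : measurableType d) (P : probability Om R) (T : nat -> Om -> Rm).
Hypothesis uT : uniform_seq P T.
Variable rho : probability C R.

Let mT : measurable_fun setT (seq_fun T) := measurable_seq_fun uT.1.

Definition scons2 (u : Rm * Rm) (t : seqR R) : seqR R := scons u.1 (scons u.2 t).

Lemma uniform_seq_unfold2 (F : seqR R -> \bar R) : (forall t, 0 <= F t) ->
  measurable_fun setT F ->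
  \int[P]_w F (seq_fun T w) = \int[lam2 R]_u \int[P]_w F (scons2 u (seq_fun T w)).
Proof.
move=> F0 mF; rewrite (uniform_seq_unfold uT F0 mF).
pose G (u : Rm * Rm) := \int[P]_w F (scons2 u (seq_fun T w)).
have mG : measurable_fun setT G.
  apply: (@measurable_fun_fubini_tonelli_F _ _ (Rm * Rm)%type Om _ P
    (fun p => F (scons2 p.1 (seq_fun T p.2)))) => //.
  apply: (measurableT_comp mF); apply: measurable_scons.
    exact: (measurableT_comp measurable_fst measurable_fst).
  apply: measurable_scons; last exact: (measurableT_comp mT measurable_snd).
  exact: (measurableT_comp measurable_snd measurable_fst).
have G0 u : 0 <= G u by apply: integral_ge0.
have -> : \int[lam2 R]_u G u = \int[lam01 (R:=R)]_u \int[lam01 (R:=R)]_v G (u, v).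
  exact: (@fubini_tonelli1 _ _ _ _ R (@lam01 R) (@lam01 R) G mG G0).
apply: eq_integral => u _.
have mFu : measurable_fun setT (fun t => F (scons u t)).
  by apply: (measurableT_comp mF); apply: measurable_scons; [exact: measurable_cst|exact: measurable_id].
by rewrite (uniform_seq_unfold uT _ mFu).
Qed.

Lemma sshift_add k l (t : seqR R) : sshift k (sshift l t) = sshift (l + k) t.
Proof. by apply/funext => i; rewrite /sshift addnA. Qed.

Lemma sshift0 (t : seqR R) : sshift 0 t = t.
Proof. by []. Qed.

Lemma sshift_scons2 u (t : seqR R) : sshift 2 (scons2 u t) = t.
Proof. by apply/funext => i; rewrite /sshift. Qed.

(* Refreshing the fresh endpoints amounts to sampling the full codes. *)
Lemma resample n (Phi : seqR R -> seq Z -> \bar R) :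
  (forall t s, 0 <= Phi t s) -> mseq n Phi ->
  iint rho n (fun cs => \int[P]_w Phi (sshift (2 * n) (seq_fun T w)) (codes cs (seq_fun T w)))
  = iint (edge_code_law rho) n (fun qs => \int[P]_w Phi (seq_fun T w) qs).
Proof.
elim: n Phi => [|n IH] Phi Phi0 mPhi.
  by rewrite /= muln0; apply: eq_integral => w _; rewrite sshift0.
rewrite /=.
(* The first code is fixed and the others are still read from [T]: once two entries are split off,
   the remaining sequence has the same law. *)
pose H c u cs := \int[P]_w Phi (sshift (2 * n) (seq_fun T w)) ((c, u) :: codes cs (seq_fun T w)).
have H0 c u cs : 0 <= H c u cs by apply: integral_ge0.
have mc c u : mseq n (fun t s => Phi t ((c, u) :: s)).
  exact: (@mseq_cons _ _ (seqR R) _ Z _ (seqR R) idfun (cst (c, u)) n Phi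
    (@measurable_id _ _ setT) (@measurable_cst _ _ _ _ setT (c, u)) mPhi).
have step c cs : size cs = n ->
   \int[P]_w Phi (sshift (2 * n.+1) (seq_fun T w)) (codes (c :: cs) (seq_fun T w)) =
   \int[lam2 R]_u H c u cs.
  move=> scs.
  rewrite (uniform_seq_unfold2 (F := fun t => Phi (sshift (2 * n.+1) t) (codes (c :: cs) t)))//.
  - apply: eq_integral => u _; apply: eq_integral => w _ /=.
    by rewrite sshift_scons2 mulnS -sshift_add sshift_scons2 -surjective_pairing.
  - apply: (@mseq_codes _ (seqR R) Phi (c :: cs) _ (seqR R) (fun t => sshift (2 * n.+1) t) idfun) => //.
    + by rewrite /= scs.
    + by apply: measurable_sshift.
    + exact: measurable_id.
have mH : forall c cs, size cs = n -> measurable_fun setT (fun u => H c u cs).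
  move=> c cs scs.
  apply: (@measurable_fun_fubini_tonelli_F _ _ (Rm * Rm)%type Om _ P
    (fun p => Phi (sshift (2 * n) (seq_fun T p.2)) ((c, p.1) :: codes cs (seq_fun T p.2)))) => //.
  apply: (@mseq_codes _ (seqR R * Z)%type (fun p s => Phi p.1 (p.2 :: s)) cs _ (Rm * Rm * Om)%type
    (fun p => (sshift (2 * n) (seq_fun T p.2), (c, p.1))) (fun p => seq_fun T p.2)).
  - rewrite scs; exact: (@mseq_cons _ _ (seqR R) _ Z _ (seqR R * Z)%type fst snd n Phi measurable_fst measurable_snd mPhi).
  - apply: measurable_fun_pair.
      by apply: measurable_sshift; exact: (measurableT_comp mT measurable_snd).
    by apply: measurable_fun_pair; [exact: measurable_cst|exact: measurable_fst].
  - exact: (measurableT_comp mT measurable_snd).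
have mHs c : mseq n (fun u cs => H c u cs).
  move=> dY Y g zs mg mzs.
  have h (y : Y) : size (mkseq (zs^~ y) n) = n by rewrite size_mkseq.
  (* Type sequences form a countable set, over which measurability is glued. Sequences of the wrong
     length, where [mH] says nothing, receive the default 0. *)
  pose F (cs : seq C) (y : Y) := if size cs == n then H c (g y) cs else 0.
  have -> : (fun y => H c (g y) (mkseq (zs^~ y) n)) = (fun y => F (mkseq (zs^~ y) n) y).
    by apply/funext => y; rewrite /F h eqxx.
  apply: (@measurable_fun_countable _ _ (seq C) (fun y => mkseq (zs^~ y) n) _ _ F).
  - move=> cs; have [scs|scs] := eqVneq (size cs) n; last first.
      have -> : [set y | mkseq (zs^~ y) n = cs] = set0 => //.
      by apply/seteqP; split => // y /= e; move: scs; rewrite -e h eqxx.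
    have -> : [set y | mkseq (zs^~ y) n = cs] =
      \bigcap_(i in [set i | (i < n)%N]) (zs i @^-1` [set nth (false, (0, 0)%N) cs i]).
      apply/seteqP; split => y /=.
        by move=> <- i /= il; rewrite nth_mkseq.
      move=> e; apply: (@eq_from_nth _ (false, (0, 0)%N)); rewrite size_mkseq// => i il.
      by rewrite nth_mkseq//; exact: e.
    apply: bigcap_measurableType => i _; rewrite -[X in measurable X]setTI.
    exact: (mzs i measurableT _ (measurable_etype _)).
  - move=> cs; rewrite /F; case: eqP => scs; last exact: measurable_cst.
    exact: (measurableT_comp (mH c cs scs) mg).
transitivity (\int[rho]_c \int[lam2 R]_u iint rho n (H c u)).
  apply: eq_integral => c _; rewrite (iint_swap rho (lam2 R))//.
  by apply: eq_iint => cs scs; exact: step.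
transitivity (\int[rho]_c \int[lam2 R]_u iint (edge_code_law rho) n (fun qs => \int[P]_w Phi (seq_fun T w) ((c, u) :: qs))).
  by apply: eq_integral => c _; apply: eq_integral => u _; exact: (IH (fun t s => Phi t ((c, u) :: s)) (fun t s => Phi0 _ _) (mc c u)).
rewrite (@integral_edge_code _ rho (fun q => iint (edge_code_law rho) n (fun qs => \int[P]_w Phi (seq_fun T w) (q :: qs))))//.
- apply: measurable_iint => [q s|]; first exact: integral_ge0.
  apply: mseq_int => [q s w|] //.
  exact: (@mseq_cons _ _ (seqR R) _ Z _ (Z * Om)%type (fun p => seq_fun T p.2) fst n Phi
    (measurableT_comp mT measurable_snd) measurable_fst mPhi).
- by move=> q; apply: iint_ge0 => s; exact: integral_ge0.
Qed.

End resampling.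

(** * Concentration of the deviation *)

Section deviation.
Context (R : realType).
Local Notation Rm := (measurableTypeR R).
Local Notation C := (bool * (nat * nat))%type.
Local Notation Z := (C * (Rm * Rm))%type.
Variable rho : probability C R.
Variable n : nat.
Hypothesis n0 : (0 < n)%N.

(** Enumeration of the closed rational rectangles. An index that decodes to nothing gives the
    degenerate rectangle at the origin, itself one of them. *)
Definition rect (a : nat) : (R * R) * (R * R) :=
  if (unpickle a : option ((rat * rat) * (rat * rat))) is Some ((p, q), (r, s)) then
    ((ratr p, ratr q), (ratr r, ratr s)) else ((0, 0), (0, 0)).

Lemma measurable_in_rect (q : (R * R) * (R * R)) : measurable [set z : Rm * Rm | in_rect q z].
Proof.
have -> : [set z : Rm * Rm | in_rect q z] = `[q.1.1, q.1.2]%classic `*` `[q.2.1, q.2.2]%classic.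
  apply/seteqP; split => -[x y]; rewrite /in_rect /= !in_itv /=; first by move=> /andP[].
  by move=> [-> ->].
by apply: measurableX; exact: measurable_itv.
Qed.

Lemma measurable_in_rect_edge q d (Y : measurableType d) (t : Y -> seqR R) (z : Y -> Z) :
  measurable_fun setT t -> measurable_fun setT z ->
  measurable_fun setT (fun y => (in_rect q (edge (t y) (z y)))%:R : R).
Proof.
move=> mt mz.
have -> : (fun y => (in_rect q (edge (t y) (z y)))%:R : R) =
   \1_[set z : Rm * Rm | in_rect q z] \o (fun y => edge (t y) (z y)).
  by apply/funext => y /=; rewrite indicE; congr (_%:R); congr nat_of_bool; apply/idP/idP; rewrite inE.
apply: measurableT_comp; last exact: measurable_edge.
by apply: measurable_indic; exact: measurable_in_rect.
Qed.

Definition rect_mass (t : seqR R) a : R := fine (edge_law rho t [set z | in_rect (rect a) z]).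

Lemma edge_law_fin t A : measurable A -> edge_law rho t A \is a fin_num.
Proof.
move=> mA; rewrite ge0_fin_numE ?measure_ge0//.
apply: (@le_lt_trans _ _ (edge_law rho t setT)).
  by apply: le_measure; rewrite ?inE.
by rewrite edge_law_setT ltry.
Qed.

Lemma rect_massE t a : (edge_law rho t [set z | in_rect (rect a) z] = (rect_mass t a)%:E)%E.
Proof. by rewrite fineK// edge_law_fin//; exact: measurable_in_rect. Qed.

Lemma rect_mass01 t a : 0 <= rect_mass t a <= 1.
Proof.
rewrite -!lee_fin -rect_massE measure_ge0/= -(edge_law_setT rho t).
by apply: le_measure; rewrite ?inE//; exact: measurable_in_rect.
Qed.

Definition dev (t : seqR R) (qs : seq Z) : \bar R :=
  nrm (fun a => rect_mass t a - (\sum_(q <- qs) (in_rect (rect a) (edge t q))%:R) / n%:R).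

Lemma dev_ge0 t qs : (0 <= dev t qs)%E.
Proof. exact: nrm_ge0. Qed.

Lemma mseq_dev k : mseq k dev.
Proof.
move=> dY Y g zs mg mzs; apply: measurable_nrm => a.
apply: measurable_funB.
  apply: measurableT_comp; first exact: fine_measurable.
  exact: (measurableT_comp (measurable_edge_law rho (measurable_in_rect (rect a))) mg).
apply: measurable_funM => //.
elim: k zs mzs => [|k IH] zs mzs.
  by under eq_fun do rewrite big_nil; exact: measurable_cst.
under eq_fun do rewrite mkseqS big_cons.
apply: measurable_funD; first exact: measurable_in_rect_edge.
by apply: (IH (fun i => zs i.+1)).
Qed.

Lemma iint_dev_le t : (iint (edge_code_law rho) n (dev t) <= (174 / Num.sqrt n%:R)%:E)%E.
Proof.
apply: (@empirical_rectangles R _ _ (edge_code_law rho) (edge t) rect (rect_mass t)) => // a.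
  exact: (@measurable_in_rect_edge _ _ _ (cst t) idfun (@measurable_cst _ _ _ _ setT t) (@measurable_id _ _ setT)).
rewrite -rect_massE.
have mr := measurable_in_rect (rect a).
rewrite -(setIT [set z | in_rect (rect a) z]) -integral_indic//.
rewrite integral_edge_law//.
  by apply: eq_integral => q _; rewrite indicE; congr (_%:R%:E); congr nat_of_bool; apply/idP/idP; rewrite inE.
by apply/measurable_EFinP; exact: measurable_indic.
Qed.

Lemma sum_rect_bounds a t (qs : seq Z) :
  0 <= (\sum_(q <- qs) (in_rect (rect a) (edge t q))%:R : R) <= (size qs)%:R.
Proof.
rewrite sumr_ge0//=; elim: qs => [|q qs IH]; first by rewrite big_nil.
rewrite big_cons /= -natr1 addrC lerD//.
by case: in_rect.
Qed.

Lemma dev_le1 t qs : size qs = n -> (dev t qs <= 1)%E.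
Proof.
move=> sq; apply: nrm_le => a; rewrite lee_fin.
have nR : 0 < n%:R :> R by rewrite ltr0n.
have := sum_rect_bounds a t qs; rewrite sq => /andP[h1 h2].
have h3 : 0 <= (\sum_(q <- qs) (in_rect (rect a) (edge t q))%:R : R) / n%:R <= 1.
  by rewrite divr_ge0//= ler_pdivrMr// mul1r.
have := rect_mass01 t a; move: h3; rewrite ler_norml => /andP[? ?] /andP[? ?].
by lra.
Qed.

Lemma dev_diff t qs1 q q' qs2 :
  (dev t (qs1 ++ q :: qs2) <= dev t (qs1 ++ q' :: qs2) + (n%:R^-1)%:E)%E.
Proof.
apply: nrm_le => a.
set x := (X in `|X|); pose y := rect_mass t a - (\sum_(p <- qs1 ++ q' :: qs2) (in_rect (rect a) (edge t p))%:R) / n%:R.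
apply: (@le_trans _ _ (`|y|%:E + (n%:R^-1)%:E)%E); last first.
  by apply: leeD => //; exact: (nrm_ub (fun a => rect_mass t a - (\sum_(p <- qs1 ++ q' :: qs2) (in_rect (rect a) (edge t p))%:R) / n%:R)).
rewrite -EFinD lee_fin.
have nR : 0 < n%:R^-1 :> R by rewrite invr_gt0 ltr0n.
have -> : x = y + ((in_rect (rect a) (edge t q'))%:R - (in_rect (rect a) (edge t q))%:R) * n%:R^-1.
  rewrite /x /y !big_cat !big_cons /=.
  ring.
apply: le_trans (ler_normD _ _) _; rewrite lerD2l normrM (gtr0_norm nR) -[leRHS]mul1r ler_pM2r//.
by case: in_rect; case: in_rect; rewrite ?subrr ?subr0 ?sub0r ?normrN ?normr0 ?normr1.
Qed.

(** The fresh endpoints of a code depend only on its position, so changing one type changes one code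
    only; this gives the bounded differences of [mean_dev]. *)
Lemma codes_cat cs1 cs2 t : codes cs1 t ++ codes cs2 (sshift (2 * size cs1) t) = codes (cs1 ++ cs2) t :> seq Z.
Proof.
elim: cs1 t => [|c cs1 IH] t /=; first by rewrite muln0 sshift0.
by rewrite -IH mulnS sshift_add.
Qed.

Context d (Om : measurableType d) (P : probability Om R) (T : nat -> Om -> Rm).
Hypothesis uT : uniform_seq P T.

Let mT : measurable_fun setT (seq_fun T) := measurable_seq_fun uT.1.

(* Mean deviation given the edge types, fresh endpoints and vertices being redrawn. *)
Definition mean_dev (cs : seq C) : \bar R :=
  (\int[P]_w dev (sshift (2 * n) (seq_fun T w)) (codes cs (seq_fun T w)))%E.

Lemma mean_dev_ge0 cs : (0 <= mean_dev cs)%E.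
Proof. by apply: integral_ge0 => w _; exact: dev_ge0. Qed.

Lemma mean_dev_le1 cs : size cs = n -> (mean_dev cs <= 1)%E.
Proof.
move=> sc; rewrite -[leRHS](integral_probability_cst P).
apply: le_lower_integral => w; first exact: dev_ge0.
by apply: dev_le1; rewrite size_codes.
Qed.

Lemma measurable_dev_codes cs :
  measurable_fun setT (fun w => dev (sshift (2 * n) (seq_fun T w)) (codes cs (seq_fun T w))).
Proof.
apply: (@mseq_codes R _ (seqR R) dev cs _ Om (fun w => sshift (2 * n) (seq_fun T w)) (seq_fun T)) => //.
  exact: mseq_dev.
exact: measurable_sshift.
Qed.

Lemma mean_dev_diff s1 z z' s2 :
  (mean_dev (s1 ++ z :: s2) <= mean_dev (s1 ++ z' :: s2) + (n%:R^-1)%:E)%E.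
Proof.
rewrite -[(n%:R^-1)%:E](integral_probability_cst P) -ge0_integralD//.
- apply: le_lower_integral => w; first exact: dev_ge0.
  by rewrite -!codes_cat; exact: dev_diff.
- by move=> w _; exact: dev_ge0.
- exact: measurable_dev_codes.
Qed.

(** After [resample] the full codes are sampled independently of the vertices; exchanging the
    integrals fixes the vertices, and [iint_dev_le] holds for each choice of them. *)
Lemma iint_mean_dev_le : (iint rho n mean_dev <= (174 / Num.sqrt n%:R)%:E)%E.
Proof.
rewrite /mean_dev (resample uT rho dev_ge0 (mseq_dev n)).
rewrite -(@iint_swap _ _ _ (edge_code_law rho) _ Om P n (fun w => dev (seq_fun T w))); last 2 first.
- by move=> w s; exact: dev_ge0.
- exact: (mseq_comp mT (mseq_dev n)).
rewrite -[leRHS](integral_probability_cst P).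
apply: le_lower_integral => w; last exact: iint_dev_le.
by apply: iint_ge0 => s; exact: dev_ge0.
Qed.

Lemma mean_dev_tail (eps : R) : 0 < eps ->
  ((1 - expR (- (2 * eps ^+ 2)))%:E <=
    iint rho n (fun cs => (if (mean_dev cs <= ((174 + eps) / Num.sqrt n%:R)%:E)%E then 1 else 0)%:E))%E.
Proof.
move=> eps0.
have nR : 0 < n%:R :> R by rewrite ltr0n.
have sn0 : 0 < Num.sqrt n%:R :> R by rewrite sqrtr_gt0.
(* The default 0 off length [n] gives a real function with values in the unit interval everywhere,
   as [mcdiarmid] demands. *)
pose F cs := if size cs == n then fine (mean_dev cs) else 0.
have fE cs : size cs = n -> mean_dev cs = (F cs)%:E.
  move=> sc; rewrite /F sc eqxx fineK// ge0_fin_numE ?mean_dev_ge0//.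
  by apply: le_lt_trans (mean_dev_le1 sc) _; rewrite ltry.
have F01 cs : 0 <= F cs <= 1.
  have [sc|sc] := eqVneq (size cs) n; last by rewrite /F (negbTE sc) lexx ler01.
  by rewrite -!lee_fin -fE// mean_dev_ge0 mean_dev_le1.
have bF : bounded_differences n F n%:R^-1.
  move=> s1 s2 z z' hs; rewrite -lee_fin EFinD -!fE ?size_cat /= ?addnS//.
  exact: mean_dev_diff.
have c0 : 0 < n%:R^-1 :> R by rewrite invr_gt0.
have t0 : 0 <= eps / Num.sqrt n%:R by rewrite divr_ge0 ?ltW.
have [m hm htail] := mcdiarmid rho (@measurable_etype) c0 t0 n0 F01 bF.
have mle : m <= 174 / Num.sqrt n%:R.
  rewrite -lee_fin -hm; apply: le_trans iint_mean_dev_le.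
  by apply: le_iint => s ss /=; [rewrite lee_fin; have /andP[] := F01 s|rewrite fE].
(* With differences [c = 1/n] and deviation [t = eps / sqrt n], [n c^2] is [1/n] and [n] cancels
   from the exponent. *)
have -> : 2 * eps ^+ 2 = 2 * (eps / Num.sqrt n%:R) ^+ 2 / (n%:R * n%:R^-1 ^+ 2).
  rewrite expr_div_n sqr_sqrtr ?(ltW nR)//; field.
  by rewrite gt_eqF.
apply: le_trans htail _; apply: le_iint => s ss; first by rewrite lee_fin; case: ifP.
rewrite fE// !lee_fin; case: ifP => h1; case: ifP => // /negP; case.
by apply: le_trans h1 _; rewrite mulrDl lerD2r.
Qed.

End deviation.

(** * Coupling *)

Section interval_approximation.
Context (R : realType).
Local Notation Rm := (measurableTypeR R).

(** If the infimum is attained the rationals approach it strictly from below, otherwise strictly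
    from above; in both cases the comparison with [x] stabilizes at the right value, also at the
    infimum itself. *)
Lemma lower_cut (S : set R) : S !=set0 -> has_lbound S ->
  exists a : nat -> rat, forall x, \forall k \near \oo,
    (ratr (a k) <= x) = `[< exists2 s, S s & s <= x >].
Proof.
move=> S0 lS; set al := inf S.
have small (e : R) : 0 < e -> \forall k \near \oo, k.+1%:R^-1 < e.
  by move=> e0; exact: (near_infty_natSinv_lt (PosNum e0)).
have i0 k : 0 < k.+1%:R^-1 :> R by rewrite invr_gt0 ltr0n.
have [Sa|nSa] := pselect (S al).
  have /choice[a ha] : forall k : nat, exists q : rat, ratr q \in `]al - k.+1%:R^-1, al[%R.
    by move=> k; apply: rat_in_itvoo; rewrite ltrBlDr ltrDl.
  exists a => x; have [alx|xal] := leP al x.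
    near=> k; have := ha k; rewrite in_itv/= => /andP[_ h].
    rewrite (le_trans (ltW h) alx); apply/esym/asboolP; by exists al.
  have d0 : 0 < al - x by rewrite subr_gt0.
  have := small _ d0; apply: filterS => k hk.
  have := ha k; rewrite in_itv/= => /andP[h _].
  have -> : (ratr (a k) <= x) = false.
    by apply/negbTE; rewrite -ltNge; apply: lt_trans h; rewrite ltrBrDr -ltrBrDl.
  apply/esym/asboolP => -[s Ss sx].
  by have := ge_inf lS Ss; rewrite -/al leNgt (le_lt_trans sx xal).
have /choice[a ha] : forall k : nat, exists q : rat, ratr q \in `]al, al + k.+1%:R^-1[%R.
  by move=> k; apply: rat_in_itvoo; rewrite ltrDl.
exists a => x; have [xal|alx] := leP x al.
  near=> k; have := ha k; rewrite in_itv/= => /andP[h _].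
  have -> : (ratr (a k) <= x) = false.
    by apply/negbTE; rewrite -ltNge; exact: le_lt_trans xal h.
  apply/esym/asboolP => -[s Ss sx].
  have h1 := ge_inf lS Ss; apply: nSa; have -> // : al = s.
  by apply/le_anti; rewrite h1 /= (le_trans sx xal).
have d0 : 0 < x - al by rewrite subr_gt0.
have := small _ d0; apply: filterS => k hk.
have := ha k; rewrite in_itv/= => /andP[_ h].
have -> : ratr (a k) <= x by apply: ltW; apply: lt_trans h _; rewrite -ltrBrDl.
apply/esym/asboolP; have [s Ss sx] := inf_lt S0 alx.
by exists s => //; exact: ltW.
Unshelve. all: by end_near. Qed.

Lemma interval_approx (S : set Rm) : sub_interval S ->
  exists ab : nat -> rat * rat, forall x, \forall k \near \oo,
    (ratr (ab k).1 <= x <= ratr (ab k).2) = `[< S x >].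
Proof.
move=> [Sunit Sitv].
have [S0|/set0P/negP/negPn/eqP ->] := pselect (S !=set0); last first.
  (* Reversed endpoints encode the empty interval. *)
  exists (fun=> (1, 0)) => x; near=> k.
  rewrite /= rmorph0 rmorph1; have -> : `[< set0 x >] = false by apply/asboolP.
  by apply/negbTE; apply/negP => /andP[h1 h2]; have := le_trans h1 h2; rewrite ler10.
have [|a ha] := lower_cut S0.
  by exists 0 => s /Sunit; rewrite /unit_itv/= in_itv/= => /andP[].
(* The upper end of [S] is the lower cut of its reflection. *)
have S0' : [set - s | s in S] !=set0 by case: S0 => s Ss; exists (- s), s.
have lS' : has_lbound [set - s | s in S].
  exists (-1) => _ [s /Sunit + <-]; rewrite /unit_itv/= in_itv/= => /andP[_ ?].
  by rewrite lerN2.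
have [b hb] := lower_cut S0' lS'.
exists (fun k => (a k, - b k)) => x.
apply: filterS2 (ha x) (hb (- x)) => k h1 h2 /=.
rewrite rmorphN lerNr h1 h2.
apply/andP/asboolP => [[/asboolP[s Ss sx] /asboolP[_ [s' Ss' <-]]]|Sx].
  by rewrite lerN2 => xs'; apply: (Sitv _ _ Ss Ss' x); rewrite sx.
split; apply/asboolP; first by exists x.
by exists (- x) => //; exists x.
Unshelve. all: by end_near. Qed.

(* Every rectangle is a pointwise limit of rational ones, which therefore already realize the supremum. *)
Lemma rect_dense (mu : {measure set (Rm * Rm) -> \bar R}) (m : nat -> R) (zs : seq (Rm * Rm)) (c b : R)
    (S T : set Rm) : (mu setT < +oo)%E -> sub_interval S -> sub_interval T ->
  (forall a, mu [set z | in_rect (rect R a) z] = (m a)%:E)%E ->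
  (forall a, `|m a - (\sum_(z <- zs) (in_rect (rect R a) z)%:R) * c| <= b) ->
  (`|mu (S `*` T) - ((\sum_(z <- zs) \1_(S `*` T) z) * c)%:E| <= b%:E)%E.
Proof.
move=> mufin hS hT hm hb.
have [ab hab] := interval_approx hS; have [cd hcd] := interval_approx hT.
pose r k : nat := pickle (ab k, cd k).
have hr k z : in_rect (rect R (r k)) z =
   (ratr (ab k).1 <= z.1 <= ratr (ab k).2) && (ratr (cd k).1 <= z.2 <= ratr (cd k).2).
  by rewrite /rect /r pickleK; case: (ab k) => ? ?; case: (cd k).
have mST : measurable (S `*` T).
  by apply: measurableX; apply: is_interval_measurable; [exact: hS.2|exact: hT.2].
have lim z : \forall k \near \oo, (in_rect (rect R (r k)) z)%:R = \1_(S `*` T) z :> R.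
  apply: filterS2 (hab z.1) (hcd z.2) => k h1 h2; rewrite hr h1 h2 indicE; congr (nat_of_bool _)%:R.
  by apply/andP/idP => [[/asboolP h3 /asboolP h4]|]; rewrite inE; [split|move=> [h3 h4]; split; apply/asboolP].
have lims : \forall k \near \oo, \sum_(z <- zs) (in_rect (rect R (r k)) z)%:R = \sum_(z <- zs) \1_(S `*` T) z :> R.
  elim: zs {hb} => [|z zs IH]; first by near=> k; rewrite !big_nil.
  by apply: filterS2 (lim z) IH => k h1 h2; rewrite !big_cons h1 h2.
(* The sum over the finite sample is eventually constant in [k]; only the [mu] part is a true limit,
   obtained by dominated convergence with the constant 1. *)
have cv : (fun k => (m (r k))%:E) @ \oo --> mu (S `*` T).
  have -> : (fun k => (m (r k))%:E) = (fun k => \int[mu]_z (\1_[set z | in_rect (rect R (r k)) z] z)%:E)%E.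
    by apply/funext => k; rewrite -hm integral_indic ?setIT//; exact: measurable_in_rect.
  have -> : mu (S `*` T) = (\int[mu]_z (\1_(S `*` T) z)%:E)%E by rewrite integral_indic ?setIT.
  apply: (@dominated_cvg _ _ _ mu setT measurableT _ _ (cst 1%E)) => //.
  - by move=> k; apply/measurable_EFinP; apply: measurable_indic; exact: measurable_in_rect.
  - move=> z _; apply: cvg_near_cst; apply: filterS (lim z) => k <-; congr (_%:E).
    by rewrite indicE; congr (nat_of_bool _)%:R; apply/idP/idP; rewrite inE.
  - apply/integrableP; split; first exact: measurable_cst.
    under eq_integral do rewrite abse1.
    by rewrite integral_cst// mul1e.
  - by move=> k z _ /=; rewrite lee_fin indicE; case: (_ \in _); rewrite ?normr1 ?normr0.
have fST : mu (S `*` T) \is a fin_num.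
  rewrite ge0_fin_numE//; apply: le_lt_trans mufin.
  by apply: le_measure; rewrite ?inE.
move: cv; rewrite -(fineK fST) => /fine_cvg cv.
rewrite -EFinB /= lee_fin.
set e := (X in _ - X * c).
have cv2 : (fun k => `|m (r k) - e * c|) @ \oo --> `|fine (mu (S `*` T)) - e * c|.
  apply: cvg_norm; apply: cvgB => //; exact: cvg_cst.
apply: (cvgr_to_le cv2); apply: filterS lims => k e1.
rewrite /e -e1; exact: hb.
Unshelve. all: by end_near. Qed.

End interval_approximation.

(** * Types read off a sample, and the matching of vertices *)

Section edge_types.
Context (R : realType).
Local Notation Rm := (measurableTypeR R).
Local Notation C := (bool * (nat * nat))%type.
Local Notation edges := (measurableTypeR R * measurableTypeR R)%type.
Variable t0 : seqR R.

(* [0] for a fresh point, [i.+1] for an atom [t0 i]. *)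
Definition label (x : Rm) : nat :=
  if pselect (exists i, t0 i = x) is left e then (projT1 (cid e)).+1 else 0%N.

Lemma label_atom x i : label x = i.+1 -> t0 i = x.
Proof. by rewrite /label; case: pselect => // e [<-]; case: (cid e). Qed.

Lemma label_fresh x i : label x = 0%N -> t0 i <> x.
Proof. by rewrite /label; case: pselect => // e _ h; apply: e; exists i. Qed.

(** Two equal non-atomic endpoints are read as an edge of the diagonal component, because two
    independent fresh points coincide with probability 0. *)
Definition etype_of (z : edges) : C :=
  if (label z.1 == 0%N) && (z.1 == z.2) then (true, (0, 0))%N else (false, (label z.1, label z.2)).

(** A fresh endpoint that repeats an earlier vertex: a null event, excluded so that each fresh
    vertex belongs to a single edge. *)
Definition clash (L : seq Rm) (z : edges) : bool :=
  ((label z.1 == 0%N) && (z.1 \in L)) || ((label z.2 == 0%N) && (z.2 \in L)).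

Fixpoint fresh_edges (L : seq Rm) (pts : seq edges) : bool :=
  if pts is z :: pts' then ~~ clash L z && fresh_edges (z.1 :: z.2 :: L) pts' else true.

Definition first_edge (pts : seq edges) (x : Rm) : nat :=
  find (fun p : edges => (x == p.1) || (x == p.2)) pts.

Lemma first_edge_fresh L pts l x : fresh_edges L pts -> (l < size pts)%N ->
  (x == (nth (0, 0) pts l).1) || (x == (nth (0, 0) pts l).2) -> label x = 0%N ->
  x \notin L /\ first_edge pts x = l.
Proof.
elim: pts L l => //= z pts IH L [|l] /andP[cz fz].
  move=> _ hx lx; split; last by rewrite /first_edge /= hx.
  apply/negP => xL; move/negP: cz; apply; rewrite /clash.
  by case/orP: hx => /eqP <-; rewrite lx eqxx xL ?orbT.
rewrite ltnS => lp hx lx; have [] := IH _ l fz lp hx lx.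
rewrite !inE !negb_or => /and3P[x1 x2 xL] e; split => //.
by rewrite /first_edge /= (negbTE x1) (negbTE x2) /=; congr _.+1.
Qed.

(* Entry of the uniform sequence assigned to a vertex: atoms are placed after the [2 n] fresh endpoints. *)
Definition vertex_code (n : nat) (pts : seq edges) (x : Rm) : nat :=
  if label x is i.+1 then (2 * n + i)%N
  else if (nth (0, 0) pts (first_edge pts x)).1 == x then (2 * first_edge pts x)%N
  else (2 * first_edge pts x).+1.

Lemma first_edge_lt pts x : x \in sample_vertices pts -> (first_edge pts x < size pts)%N.
Proof.
rewrite mem_undup => /flattenP[_ /mapP[p hp ->]]; rewrite !inE => hx.
by rewrite -has_find; apply/hasP; exists p.
Qed.

(** An index below [2 n] determines its vertex: its half is the position of an edge containing it,
    its parity tells which endpoint. Injectivity makes the labels chosen for the graph independent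
    and uniform. *)
Lemma vertex_code_inj pts : {in sample_vertices pts &, injective (vertex_code (size pts) pts)}.
Proof.
move=> x y hx hy; rewrite /vertex_code.
have lx := first_edge_lt hx; have ly := first_edge_lt hy.
case ex : (label x) => [|i]; case ey : (label y) => [|j].
- have fx : has (fun p : edges => (x == p.1) || (x == p.2)) pts by rewrite has_find.
  have fy : has (fun p : edges => (y == p.1) || (y == p.2)) pts by rewrite has_find.
  case: eqP => [e1|n1]; case: eqP => [e2|n2] e; try by exfalso; lia.
    have e' : first_edge pts x = first_edge pts y by lia.
    by rewrite -e1 -e2 e'.
  have e' : first_edge pts x = first_edge pts y by lia.
  have := nth_find (0, 0) fy; have := nth_find (0, 0) fx.
  rewrite -/(first_edge pts x) -/(first_edge pts y) -e'.
  move=> /orP[/eqP h1|/eqP h1]; first by case: n1.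
  by move=> /orP[/eqP h2|/eqP h2]; [case: n2; rewrite -e'|rewrite h1].
- by case: eqP => _ e; lia.
- by case: eqP => _ e; lia.
- move=> e; have ij : i = j by lia.
  by rewrite -(label_atom ex) -(label_atom ey) ij.
Qed.

(** The identity behind the coupling: a relabelled sampled edge is the edge decoded from its type
    with the atoms of the redrawn grapheur, since both read the same entries of [t]. *)
Lemma vertex_code_edge pts l (t : seqR R) : fresh_edges [::] pts -> (l < size pts)%N ->
  let p := nth (0, 0) pts l in
  edge (sshift (2 * size pts) t) (etype_of p, (t (2 * l)%N, t (2 * l).+1)) =
  (t (vertex_code (size pts) pts p.1), t (vertex_code (size pts) pts p.2)).
Proof.
move=> fp lp /=; set p := nth _ _ _.
have f1 : label p.1 = 0%N -> vertex_code (size pts) pts p.1 = (2 * l)%N.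
  move=> e; have [|_ el] := first_edge_fresh fp lp _ e; first by rewrite eqxx.
  by rewrite /vertex_code e el eqxx.
have f2 : label p.2 = 0%N -> p.1 != p.2 -> vertex_code (size pts) pts p.2 = (2 * l).+1.
  move=> e ne; have [|_ el] := first_edge_fresh fp lp _ e; first by rewrite eqxx orbT.
  by rewrite /vertex_code e el -/p (negbTE ne).
have fa x i : label x = i.+1 -> vertex_code (size pts) pts x = (2 * size pts + i)%N.
  by rewrite /vertex_code => ->.
rewrite /etype_of /edge; case h : ((label p.1 == 0%N) && (p.1 == p.2)) => /=.
  by move/andP: h => [/eqP e1 /eqP e2]; rewrite -e2 f1.
congr (_, _).
  by case e : (label p.1) => [|i] /=; [rewrite f1|rewrite (fa _ _ e)].
case e : (label p.2) => [|i] /=; last by rewrite (fa _ _ e).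
rewrite f2//; apply/eqP => e12; move: h.
by rewrite e12 e !eqxx.
Qed.

End edge_types.

(** * The coupling and its cost *)

Section coupling.
Context (R : realType) d (Om : measurableType d) (P : probability Om R).
Local Notation Rm := (measurableTypeR R).
Local Notation C := (bool * (nat * nat))%type.
Variable (T : nat -> Om -> Rm).
Hypothesis iT : iid_uniform01 P T.
Variables (E : nat -> nat -> R) (sg vs : nat -> R) (th vth : R) (rho : probability C R).
Hypothesis rhoE : etype_law E sg vs th vth rho.

(** The redrawn grapheur uses the entries of [T] from [2 n] on, the redrawn graph those given by
    [vertex_code]. The observed vertices [t0] survive only through the types, and the expected
    supremum for this coupling is at most [mean_dev]. *)
Lemma Wbox_bar_le (t0 : seqR R) pts : (0 < size pts)%N -> fresh_edges t0 [::] pts ->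
  (Wbox_bar P (grapheur_rm E sg vs th vth T) P
     (fun w => graph_measure (sample_graph pts) (fun i => T i w))
   <= mean_dev rho (size pts) P T (map (etype_of t0) pts))%E.
Proof.
move=> n0 fp; set n := size pts in n0 *.
set V := sample_vertices pts; pose s := vertex_code t0 n pts.
pose big := (\max_(j < size V) s (nth 0%R V j)).+1.
(* Indices beyond the vertices are sent past all used entries, which extends the labelling to an
   injection of [nat]. *)
pose s' i := if (i < size V)%N then s (nth 0%R V i) else (big + i)%N.
have s_lt i : (i < size V)%N -> (s (nth 0%R V i) < big)%N.
  by move=> iV; rewrite ltnS; exact: (leq_bigmax (Ordinal iV)).
have inj_s' : injective s'.
  move=> i j; rewrite /s'; case: ltnP => hi; case: ltnP => hj.
  - move=> e; have := @vertex_code_inj _ t0 pts _ _ (mem_nth 0 hi) (mem_nth 0 hj) e.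
    by move/eqP; rewrite nth_uniq ?undup_uniq// => /eqP.
  - by move=> e; have := s_lt _ hi; rewrite e; lia.
  - by move=> e; have := s_lt _ hj; rewrite -e; lia.
  - by lia.
pose X1 i := T (2 * n + i)%N; pose X2 i := T (s' i).
have u0 : uniform_seq P T by apply: (@iid_uniform_seq _ _ _ P T id).
have u1 : uniform_seq P X1 by apply: (iid_uniform_seq iT); exact: addnI.
have u2 : uniform_seq P X2 by exact: (iid_uniform_seq iT).
pose mG := graph_measure (sample_graph pts).
have lawM (t : seqR R) A (mA : measurable A) := grapheur_edge_law rhoE t mA.
have mM A : measurable A -> measurable_fun setT (fun t : seqR R => grapheur_measure E sg vs th vth t A).
  move=> mA; have -> : (fun t : seqR R => grapheur_measure E sg vs th vth t A) =
     (fun t : seqR R => edge_law rho t A) by apply/funext => t; rewrite lawM.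
  exact: measurable_edge_law.
have lawG t A : measurable A -> mG t A = graph_points pts t A by move=> _; exact: graph_pointsE.
have mmG A : measurable A -> measurable_fun setT (fun t : seqR R => mG t A).
  exact: measurable_graph_measure.
apply: (@le_trans _ _ (\int[P]_w ereal_sup [set x | exists S T' : set Rm,
    sub_interval S /\ sub_interval T' /\
    x = `|grapheur_measure E sg vs th vth (seq_fun X1 w) (S `*` T') - mG (seq_fun X2 w) (S `*` T')|])%E).
  apply: ereal_inf_lbound; exists d, Om, P, (fun w => grapheur_measure E sg vs th vth (seq_fun X1 w)),
    (fun w => mG (seq_fun X2 w)); split => //.
  split; first exact: (seq_random_measure lawM mM u1.1).
  split; first exact: (seq_random_measure lawG mmG u2.1).
  split; first exact: (seq_same_law mM u1 u0).
  exact: (seq_same_law mmG u2 u0).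
apply: le_lower_integral => w.
  (* The pair of empty intervals shows that the supremum is nonnegative. *)
  apply: (@le_trans _ _ (`|grapheur_measure E sg vs th vth (seq_fun X1 w) (set0 `*` set0) - mG (seq_fun X2 w) (set0 `*` set0)|)%E) => //.
  apply: ereal_sup_ubound; exists set0, set0; do ?split => //.
apply: ge_ereal_sup => _ [S [T' [hS [hT ->]]]].
have mST : measurable (S `*` T').
  by apply: measurableX; apply: is_interval_measurable; [exact: hS.2|exact: hT.2].
rewrite lawM// /mG graph_measureE -/n.
set t := seq_fun T w.
have e1 : seq_fun X1 w = sshift (2 * n) t by [].
pose zs := [seq (t (s p.1), t (s p.2)) : Rm * Rm | p <- pts].
have hzs (f : Rm * Rm -> R) :
   \sum_(p <- pts) f (seq_fun X2 w (vertex_index pts p.1), seq_fun X2 w (vertex_index pts p.2)) =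
   \sum_(z <- zs) f z.
  rewrite /zs big_map; apply: eq_big_seq => p hp.
  rewrite /seq_fun /X2 /s' /vertex_index !index_mem sample_vertices_fst// sample_vertices_snd//.
  by rewrite !nth_index ?sample_vertices_fst// sample_vertices_snd.
have hcodes : zs = [seq edge (sshift (2 * n) t) q | q <- codes (map (etype_of t0) pts) t].
  rewrite codesE size_map /mkseq -map_comp /zs -{1}(mkseq_nth (0, 0) pts) /mkseq -map_comp.
  apply/eq_in_map => l; rewrite mem_iota /= add0n => ln.
  by rewrite (nth_map (0, 0))// vertex_code_edge.
rewrite (hzs (fun z => \1_(S `*` T') z)) e1.
have : (0 <= dev rho n (sshift (2 * n) t) (codes (map (etype_of t0) pts) t))%E by exact: dev_ge0.
have : (dev rho n (sshift (2 * n) t) (codes (map (etype_of t0) pts) t) <= 1)%E.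
  by apply: dev_le1 => //; rewrite size_codes size_map.
case eb : (dev _ _ _ _) => [b| |] // _ _.
apply: (rect_dense (m := rect_mass rho (sshift (2 * n) t))) => //.
- by rewrite edge_law_setT ltry.
- by move=> a; exact: rect_massE.
- move=> a; rewrite -lee_fin -eb hcodes big_map.
  exact: (nrm_ub (fun a => rect_mass rho (sshift (2 * n) t) a - (\sum_(q <- codes (map (etype_of t0) pts) t) (in_rect (rect R a) (edge (sshift (2 * n) t) q))%:R) / n%:R)).
Qed.

End coupling.

(** * Recovering the edge types *)

Section recover_types.
Context (R : realType).
Local Notation Rm := (measurableTypeR R).
Local Notation C := (bool * (nat * nat))%type.
Local Notation edges := (measurableTypeR R * measurableTypeR R)%type.
Local Open Scope ereal_scope.

Lemma lam01_countable (A : set Rm) : countable A -> lam01 A = 0.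
Proof.
move=> cA; apply/eqP; rewrite eq_le measure_ge0 andbT -(countable_lebesgue_measure0 cA).
have mA : measurable A := countable_measurable (@measurable_set1 R) cA.
apply: le_measure; rewrite ?inE.
- by apply: measurableI => //; exact: measurable_unit_itv.
- exact: mA.
- exact: subIsetl.
Qed.

Lemma measurable_diag : measurable [set u : edges | u.1 = u.2].
Proof.
have := @measurable_fun_eqr _ edges R setT fst snd measurable_fst measurable_snd.
move=> /(_ measurableT [set true] I); rewrite setTI; congr (measurable _).
by apply/seteqP; split => u /=; [move/eqP|move=> ->; rewrite eqxx].
Qed.

Lemma lam2_diag : lam2 R [set u | u.1 = u.2] = 0.
Proof.
rewrite /lam2; apply: etrans (_ : \int[lam01 (R:=R)]_x 0 = 0); last exact: integral0.
apply: eq_integral => x _ /=.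
by have -> : xsection [set u : edges | u.1 = u.2] x = [set x];
  [apply/seteqP; split => y; rewrite /xsection /= inE|exact: lam01_set1].
Qed.

Variable t0 : seqR R.
Hypothesis t0_inj : injective t0.

Let label_t0 i : label t0 (t0 i) = i.+1.
Proof.
case e : (label t0 (t0 i)) => [|j]; first by case: (label_fresh (i := i) e).
by rewrite (t0_inj (label_atom e)).
Qed.

Let measurable_label k : measurable [set x : Rm | label t0 x = k].
Proof.
case: k => [|i].
  have -> : [set x : Rm | label t0 x = 0%N] = ~` range t0.
    apply/seteqP; split => x /=.
      by move=> e [i _ h]; exact: (label_fresh e h).
    move=> h; case e : (label t0 x) => [|i] //; case: h; exists i => //; exact: label_atom e.
  apply: measurableC; apply: (countable_measurable (@measurable_set1 R)).
  exact: sub_countable (card_image_le _ _) (countableP _).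
have -> : [set x : Rm | label t0 x = i.+1] = [set (t0 i : Rm)]; last exact: measurable_set1.
apply/seteqP; split => x /=; last by move=> ->.
by move=> /label_atom ->.
Qed.


Let measurable_etype_of c : measurable [set z : edges | etype_of t0 z = c].
Proof.
have md : measurable [set z : edges | z.1 = z.2] := measurable_diag.
have m1 k : measurable [set z : edges | label t0 z.1 = k].
  by rewrite -[X in measurable X]setTI; exact: (measurable_fst measurableT _ (measurable_label k)).
have m2 k : measurable [set z : edges | label t0 z.2 = k].
  by rewrite -[X in measurable X]setTI; exact: (measurable_snd measurableT _ (measurable_label k)).
pose D := [set z : edges | label t0 z.1 = 0%N] `&` [set z : edges | z.1 = z.2].
have mD : measurable D by exact: measurableI.
have hD z : ((label t0 z.1 == 0%N) && (z.1 == z.2)) = `[< D z >].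
  by apply/andP/asboolP => [[/eqP ? /eqP ?]|[-> ->]]; rewrite ?eqxx.
case: c => b [i j].
have -> : [set z | etype_of t0 z = (b, (i, j))] =
   (if (b, (i, j)) == (true, (0, 0))%N then D else set0) `|`
   ((if b then set0 else ~` D) `&` ([set z | label t0 z.1 = i] `&` [set z | label t0 z.2 = j])).
  apply/seteqP; split => z /=.
    rewrite /etype_of hD; case: asboolP => h [<- <- <-]; first by left; rewrite eqxx.
    by right; split.
  rewrite /etype_of hD => -[|[]].
    case: eqP => [[-> -> ->]|//] h; by case: asboolP.
  by case: b => // /= h [<- <-]; case: asboolP.
apply: measurableU; first by case: ifP.
by apply: measurableI; [case: b => //; exact: measurableC|exact: measurableI].
Qed.

Lemma measurable_fun_etype_of (f : C -> \bar R) : measurable_fun setT (fun z => f (etype_of t0 z)).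
Proof.
apply: (@measurable_fun_countable _ _ C (etype_of t0) _ _ (fun c _ => f c)) => //.
Qed.

Lemma measurable_clash L : measurable [set z | clash t0 L z].
Proof.
have mL : measurable [set x : Rm | x \in L].
  apply: (countable_measurable (@measurable_set1 R)); apply: finite_set_countable.
  exact: finite_seq.
have mF : measurable [set x : Rm | label t0 x = 0%N /\ x \in L].
  exact: (measurableI _ _ (measurable_label 0%N) mL).
have -> : [set z | clash t0 L z] = [set z : edges | label t0 z.1 = 0%N /\ z.1 \in L] `|`
    [set z : edges | label t0 z.2 = 0%N /\ z.2 \in L].
  apply/seteqP; split => z; rewrite /clash /=.
    by move=> /orP[/andP[/eqP ? ?]|/andP[/eqP ? ?]]; [left|right].
  by move=> [[-> ->]|[-> ->]]; rewrite // orbT.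
apply: measurableU; rewrite -[X in measurable X]setTI.
  exact: (measurable_fst measurableT _ mF).
exact: (measurable_snd measurableT _ mF).
Qed.

Variables (E : nat -> nat -> R) (sg vs : nat -> R) (th vth : R) (rho : probability C R).
Hypothesis rhoE : etype_law E sg vs th vth rho.

(** Unless a fresh point meets [L], an atom or the other fresh point, which is a null event, the
    type read off [edge t0 (c, u)] is [c]. Types of edges drawn from the grapheur thus have law
    [rho], and [g] is prescribed only away from clashes. *)
Lemma integral_etype_of L (g : edges -> \bar R) (f : C -> \bar R) :
  measurable_fun setT g -> (forall z, 0 <= g z) -> (forall c, 0 <= f c) ->
  (forall z, ~~ clash t0 L z -> g z = f (etype_of t0 z)) ->
  \int[edge_law rho t0]_z g z = \int[rho]_c f c.
Proof.
move=> mg g0 f0 gf.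
have me c : measurable_fun setT (fun u : edges => edge t0 (c, u)).
  exact: (@measurable_edge_type _ _ _ (cst t0) c idfun (@measurable_cst _ _ _ _ setT t0) (@measurable_id _ _ setT)).
rewrite integral_edge_law// integral_edge_code//; last first.
  exact: measurableT_comp mg (measurable_edge2 t0).
pose A : set Rm := [set x | x \in L] `|` range t0.
have cA : countable A.
  rewrite /A -bigcup2inE; apply: bigcup_countable => [|k _]; first exact: countableP.
  rewrite /bigcup2; case: k => [|[|k]]; last exact: countable0.
    exact/finite_set_countable/finite_seq.
  exact: sub_countable (card_image_le _ _) (countableP _).
have mA : measurable A := countable_measurable (@measurable_set1 R) cA.
pose N : set edges := [set u | A u.1] `|` [set u | A u.2] `|` [set u | u.1 = u.2].
have mN1 : measurable [set u : edges | A u.1].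
  by rewrite -[X in measurable X]setTI; exact: (measurable_fst measurableT _ mA).
have mN2 : measurable [set u : edges | A u.2].
  by rewrite -[X in measurable X]setTI; exact: (measurable_snd measurableT _ mA).
have negN : (lam2 R).-negligible N.
  apply: negligibleU; first apply: negligibleU.
  - by apply/negligibleP => //; apply: etrans (lam2_fst mA) _; exact: lam01_countable.
  - by apply/negligibleP => //; apply: etrans (lam2_snd mA) _; exact: lam01_countable.
  - by apply/negligibleP; [exact: measurable_diag|exact: lam2_diag].
(* A type with flag [true] and other indices would be read back as [tD]; [rhoE] gives such types no
   mass. *)
have key (c : C) : (c.1 -> c.2 = (0, 0)%N) -> \int[lam2 R]_u g (edge t0 (c, u)) = f c.
  move=> hc; rewrite -[RHS](integral_probability_cst (lam2 R)).
  apply: ge0_ae_eq_integral => //.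
    exact: measurableT_comp mg (me c).
  apply: negligibleS negN => u /= hu; apply: contrapT => nN; apply: hu => _.
  have n1 : ~ A u.1 by move=> h; apply: nN; left; left.
  have n2 : ~ A u.2 by move=> h; apply: nN; left; right.
  have n12 : u.1 != u.2 by apply/eqP => h; apply: nN; right.
  have l0 x : ~ A x -> label t0 x = 0%N.
    move=> nx; case e : (label t0 x) => [|i] //; exfalso; apply: nx; right.
    by exists i => //; exact: label_atom e.
  have nL x : ~ A x -> x \notin L by move=> nx; apply/negP => h; apply: nx; left.
  have lv i x : ~ A x -> label t0 (vtx t0 i x) = i /\ ((label t0 (vtx t0 i x) == 0%N) && (vtx t0 i x \in L)) = false.
    by move=> nx; case: i => [|i] /=; [rewrite l0//= (negbTE (nL _ nx))|rewrite label_t0].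
  have et : etype_of t0 (edge t0 (c, u)) = c.
    case: c hc => -[] [i j] /= hc.
      by rewrite /etype_of /edge /= l0// !eqxx /= hc.
    rewrite /etype_of /edge /= (lv i _ n1).1 (lv j _ n2).1; case: ifP => // /andP[/eqP i0 /eqP h].
    exfalso; move: h; rewrite i0 /= => h; case: j {hc} h => [|j] /= h.
      by move/eqP: n12; apply.
    by apply: n1; right; exists j.
  rewrite gf ?et// /clash; case: c hc {et} => -[] [i j] /= hc.
    by rewrite /edge /= (negbTE (nL _ n1)) !andbF.
  by rewrite /edge /= (lv i _ n1).2 (lv j _ n2).2.
rewrite !rhoE//; last by move=> c; exact: integral_ge0.
rewrite !key//; congr (_ + _ + _ + _ + _); apply: eq_eseriesr => i _; rewrite ?key//.
by apply: eq_eseriesr => j _; rewrite key.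
Qed.

(** As [F] may fail to be measurable, it is dominated by the measurable [g], set to [+oo] on the
    null event of a clash. Each step adds the endpoints of the drawn edge to [L]. *)
Lemma iint_edge_law_le n L (F : seq edges -> \bar R) (h : seq C -> \bar R) :
  (forall s, 0 <= F s) -> (forall cs, 0 <= h cs) ->
  (forall s, size s = n -> fresh_edges t0 L s -> F s <= h (map (etype_of t0) s)) ->
  iint (edge_law rho t0) n F <= iint rho n h.
Proof.
elim: n L F h => [|n IH] L F h F0 h0 Fh /=; first exact: (Fh [::]).
pose f c := iint rho n (fun cs => h (c :: cs)).
have f0 c : 0 <= f c by apply: iint_ge0.
pose g z := if clash t0 L z then +oo else f (etype_of t0 z).
rewrite -(@integral_etype_of L g f)//.
- apply: (@le_lower_integral _ _ _ (edge_law rho t0) (fun z => iint (edge_law rho t0) n (fun s => F (z :: s))) g) => z; first exact: iint_ge0.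
  rewrite /g; case: ifP => cz; first exact: leey.
  apply: (IH (z.1 :: z.2 :: L)) => // s ss fs.
  by apply: (Fh (z :: s)); rewrite /= ?ss// cz.
- apply: measurable_fun_ifT.
  + by apply: (measurable_fun_bool true); rewrite setTI; exact: measurable_clash.
  + exact: measurable_cst.
  + exact: measurable_fun_etype_of.
- by move=> z; rewrite /g; case: ifP.
- by move=> z cz; rewrite /g (negbTE cz).
Qed.

(** Dual of the preceding bound, with a measurable minorant equal to 0 on clashes; it transports
    lower bounds on probabilities. *)
Lemma iint_edge_law_ge n L (F : seq edges -> \bar R) (h : seq C -> \bar R) :
  (forall s, 0 <= F s) -> (forall cs, 0 <= h cs) ->
  (forall s, size s = n -> fresh_edges t0 L s -> h (map (etype_of t0) s) <= F s) ->
  iint rho n h <= iint (edge_law rho t0) n F.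
Proof.
elim: n L F h => [|n IH] L F h F0 h0 Fh /=; first exact: (Fh [::]).
pose f c := iint rho n (fun cs => h (c :: cs)).
have f0 c : 0 <= f c by apply: iint_ge0.
pose g z := if clash t0 L z then 0 else f (etype_of t0 z).
rewrite -(@integral_etype_of L g f)//.
- apply: (@le_lower_integral _ _ _ (edge_law rho t0) g (fun z => iint (edge_law rho t0) n (fun s => F (z :: s)))) => z; first by rewrite /g; case: ifP.
  rewrite /g; case: ifP => cz; first exact: iint_ge0.
  apply: (IH (z.1 :: z.2 :: L)) => // s ss fs.
  by apply: (Fh (z :: s)); rewrite /= ?ss// cz.
- apply: measurable_fun_ifT.
  + by apply: (measurable_fun_bool true); rewrite setTI; exact: measurable_clash.
  + exact: measurable_cst.
  + exact: measurable_fun_etype_of.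
- by move=> z; rewrite /g; case: ifP.
- by move=> z cz; rewrite /g (negbTE cz).
Qed.

End recover_types.

(** * Bounds on lower integrals from almost sure bounds *)

Section almost_sure_bounds.
Context (R : realType) d (Om : measurableType d) (P : probability Om R).
Local Open Scope ereal_scope.
Variable D : set Om.
Hypotheses (mD : measurable D) (PD : P (~` D) = 0).

Let ae_cst (x y : \bar R) : 0 <= x -> 0 <= y -> \int[P]_w (if w \in D then x else y) = x.
Proof.
move=> x0 y0; rewrite -[RHS](integral_probability_cst P).
apply: ge0_ae_eq_integral => //.
- apply: measurable_fun_ifT; [|exact: measurable_cst|exact: measurable_cst].
  apply: (measurable_fun_bool true); rewrite setTI.
  by have -> : (fun w => w \in D) @^-1` [set true] = D by apply/seteqP; split => w; [exact: set_mem|exact: mem_set].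
- by move=> w _; case: ifP.
- exists (~` D); split => //; first exact: measurableC.
  by move=> w /= h Dw; apply: h => _; rewrite mem_set.
Qed.

(** The measurable majorant equal to [K] on [D] and to [+oo] elsewhere has integral [K], because the
    complement of [D] is null. *)
Lemma lower_integral_le_ae (G : Om -> \bar R) (K : \bar R) : (forall w, 0 <= G w) -> 0 <= K ->
  (forall w, D w -> G w <= K) -> \int[P]_w G w <= K.
Proof.
move=> G0 K0 GK; rewrite -[leRHS](ae_cst K0 (leey 0)).
apply: le_lower_integral => // w.
by case: (pselect (D w)) => Dw; [rewrite mem_set//; exact: GK|rewrite memNset//; exact: leey].
Qed.

Lemma lower_integral_ge_ae (G : Om -> \bar R) (K : \bar R) : (forall w, 0 <= G w) -> 0 <= K ->
  (forall w, D w -> K <= G w) -> K <= \int[P]_w G w.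
Proof.
move=> G0 K0 GK; rewrite -[leLHS](ae_cst K0 (lexx 0)).
apply: le_lower_integral => w; first by case: ifP.
by case: (pselect (D w)) => Dw; [rewrite mem_set//; exact: GK|rewrite memNset].
Qed.

End almost_sure_bounds.

Section distinct_vertices.
Context (R : realType) d (Om : measurableType d) (P : probability Om R).
Local Notation Rm := (measurableTypeR R).
Variable (T : nat -> Om -> Rm).
Hypothesis iT : iid_uniform01 P T.

Let meq i j : measurable [set w | T i w = T j w].
Proof.
have := measurable_fun_pair (iT.1 i) (iT.1 j).
move=> /(_ measurableT _ (@measurable_diag R)); rewrite setTI; exact.
Qed.

Lemma iid_uniform_neq i j : i != j -> P [set w | T i w = T j w] = 0%E.
Proof.
(* An injection starting with [i], [j]: for [k >= 2], [i + j + k] exceeds both. The pair then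
   becomes the first two entries of a uniform sequence. *)
move=> ij; pose s k := if k == 0%N then i else if k == 1%N then j else (i + j + k)%N.
have inj_s : injective s.
  move=> k l; rewrite /s; case: k => [|[|k]]; case: l => [|[|l]] //=; by move: ij => /eqP; lia.
have us := iid_uniform_seq iT inj_s.
pose F (t : seqR R) : \bar R := (\1_[set u : Rm * Rm | u.1 = u.2] (t 0%N : Rm, t 1%N : Rm))%:E.
have mF : measurable_fun setT F.
  apply/measurable_EFinP; apply: measurableT_comp.
    by apply: measurable_indic; exact: measurable_diag.
  by apply: measurable_fun_pair; exact: measurable_coord.
have F0 t : (0 <= F t)%E by rewrite lee_fin.
have := uniform_seq_unfold2 us F0 mF.
have -> : (\int[P]_w F (seq_fun (fun i0 => T (s i0)) w) = P [set w | T i w = T j w])%E.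
  rewrite -(setIT [set w | T i w = T j w]) -integral_indic//; apply: eq_integral => w _; congr (_%:E).
move=> ->; rewrite -(@lam2_diag R) -(setIT [set u : Rm * Rm | u.1 = u.2]).
rewrite -[RHS](integral_indic (lam2 R) measurableT (@measurable_diag R)).
apply: eq_integral => -[u v] _.
exact: (integral_probability_cst P (\1_[set u : Rm * Rm | u.1 = u.2] (u, v))%:E).
Qed.

Lemma distinct_vertices : exists D : set Om, [/\ measurable D, P (~` D) = 0%E &
  forall w, D w -> injective (fun i => T i w)].
Proof.
pose B i j := if i != j then [set w | T i w = T j w] else set0.
have mB i j : measurable (B i j) by rewrite /B; case: ifP.
have nB i j : P.-negligible (B i j).
  apply/negligibleP => //; rewrite /B; case: ifPn => [ij|_]; last exact: measure0.
  exact: iid_uniform_neq.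
have mU : measurable (\bigcup_i \bigcup_j B i j).
  by apply: bigcup_measurable => i _; apply: bigcup_measurable.
exists (~` \bigcup_i \bigcup_j B i j); split; first exact: measurableC.
  rewrite setCK; apply/(negligibleP _ mU); apply: negligible_bigcup => i; exact: negligible_bigcup.
move=> w nw i j e; apply/eqP; apply: contrapT => /negP ij; apply: nw.
by exists i => //; exists j => //; rewrite /B ij.
Qed.

End distinct_vertices.

Lemma Wbox_ge0 (R : realType) d1 (Om1 : measurableType d1) (P1 : probability Om1 R) M1
    d2 (Om2 : measurableType d2) (P2 : probability Om2 R) M2 :
  (0 <= Wbox P1 M1 P2 M2)%E.
Proof.
apply: le_ereal_inf_tmp => _ [d [Om [P [N1 [N2 [_ ->]]]]]].
apply: (@le_trans _ _ (\int[P]_w `|N1 w (set0 `*` set0) - N2 w (set0 `*` set0)|)%E).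
  by apply: integral_ge0 => w _; exact: abse_ge0.
apply: ereal_sup_ubound; exists set0, set0; do ?split => //.
Qed.

Lemma Wbox_le_bar (R : realType) d1 (Om1 : measurableType d1) (P1 : probability Om1 R) M1
    d2 (Om2 : measurableType d2) (P2 : probability Om2 R) M2 :
  (Wbox P1 M1 P2 M2 <= Wbox_bar P1 M1 P2 M2)%E.
Proof.
apply: le_ereal_inf_tmp => _ [d [Om [P [N1 [N2 [cpl ->]]]]]].
apply: (@le_trans _ _ (ereal_sup [set x | exists S T : set (measurableTypeR R),
           sub_interval S /\ sub_interval T /\
           x = (\int[P]_w `|N1 w (S `*` T) - N2 w (S `*` T)|)%E])).
  by apply: ereal_inf_lbound; exists d, Om, P, N1, N2.
apply: ge_ereal_sup => _ [S [T [hS [hT ->]]]].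
apply: le_lower_integral => w; first exact: abse_ge0.
by apply: ereal_sup_ubound; exists S, T.
Qed.

(** For fixed [pts] only the laws of the two random measures enter the distances, so the labels of
    [MG] can be taken from the same [T] as [M]. *)
Theorem mainTheorem12 (R : realType) (d : measure_display)
    (Om : measurableType d) (P : probability Om R)
    (T : nat -> Om -> measurableTypeR R)
    (E : nat -> nat -> R) (sg vs : nat -> R) (th vth : R) (n : nat) :
  iid_uniform01 P T ->
  grapheur_coeffs E sg vs th vth ->
  (0 < n)%N ->
  let M := grapheur_rm E sg vs th vth T in
  let MG := fun pts => (fun w => graph_measure (sample_graph pts) (fun i => T i w)) in
  let W := fun pts => Wbox P M P (MG pts) in
  let Wb := fun pts => Wbox_bar P M P (MG pts) in
  (sample_expect P M n W <= sample_expect P M n Wb)%E /\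
  (sample_expect P M n Wb <= (174 / Num.sqrt n%:R)%:E)%E /\
  (forall eps : R, 0 < eps ->
     ((1 - expR (- (2 * eps ^+ 2)))%:E <=
      sample_expect P M n (fun pts =>
        if (W pts <= Wb pts)%E && (Wb pts <= ((174 + eps) / Num.sqrt n%:R)%:E)%E
        then 1%E else 0%E))%E).
Proof.
move=> iT hcoef n0 M MG W Wb.
have [rho rhoE] := etype_law_exists hcoef.
have uT : uniform_seq P T by apply: (@iid_uniform_seq _ _ _ P T id).
have [D [mD PD injD]] := distinct_vertices iT.
have WWb pts : (W pts <= Wb pts)%E by exact: Wbox_le_bar.
have W0 pts : (0 <= W pts)%E by exact: Wbox_ge0.
have Wb0 pts : (0 <= Wb pts)%E by exact: le_trans (W0 pts) (WWb pts).
(* From here on the samples are drawn from the genuine measure [edge_law], which agrees with the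
   grapheur on measurable sets. *)
have sE F : sample_expect P M n F = (\int[P]_w iint (edge_law rho (seq_fun T w)) n F)%E.
  apply: eq_integral => w _; rewrite iid_integralE.
  by apply: eq_set_function_iint => A mA; exact: (grapheur_edge_law rhoE).
have Wb_le w pts : size pts = n -> fresh_edges (seq_fun T w) [::] pts ->
    (Wb pts <= mean_dev rho n P T (map (etype_of (seq_fun T w)) pts))%E.
  move=> sp fp; have n0' : (0 < size pts)%N by rewrite sp.
  by have := Wbox_bar_le iT rhoE n0' fp; rewrite sp.
split; [|split].
- rewrite !sE; apply: le_lower_integral => w; first by apply: iint_ge0.
  by apply: le_iint => s _.
- rewrite sE; apply: (lower_integral_le_ae mD PD).
  + by move=> w; apply: iint_ge0.
  + by rewrite lee_fin divr_ge0 ?sqrtr_ge0.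
  + move=> w /injD inj; apply: le_trans (iint_mean_dev_le rho n0 uT).
    apply: (iint_edge_law_le inj rhoE (L := [::])) => // [cs|s ss fs]; first exact: mean_dev_ge0.
    exact: Wb_le.
- move=> eps eps0; rewrite sE; apply: (lower_integral_ge_ae mD PD).
  + by move=> w; apply: iint_ge0 => s; case: ifP.
  + by rewrite lee_fin subr_ge0 -expR0 ler_expR oppr_le0 mulr_ge0 ?sqr_ge0.
  + move=> w /injD inj; apply: le_trans (mean_dev_tail rho n0 uT eps0) _.
    (* On samples without clashes, [mean_dev] below the threshold forces [Wb] below it, so the tail
       event for types is contained in the one for graphs. *)
    apply: (iint_edge_law_ge inj rhoE (L := [::])) => // [s|cs|s ss fs].
    * by case: ifP.
    * by case: ifP.
    * case: ifP => h; last by case: ifP.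
      by rewrite WWb /= (le_trans (Wb_le w s ss fs) h).
Qed.
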